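(* Consider the Gaussian sequential learning model with smooth randomized response described in the context, where each agent's privacy budget $\varepsilon_n$ is drawn independently from a distribution $G$ supported on $[0,a]$ (for some $a>0$) with $G(\{0\})=0$. Then the convergence rate of the public log-likelihood ratio is upper bounded by order $\Theta(\sqrt n)$ and lower bounded by order $\Theta(\log n)$: conditional on $\theta=+1$, almost surely $l_n=O(\sqrt n)$ and $l_n=\Omega(\log n)$ as $n\to\infty$.
   Context: Gaussian model: unknown state $\theta\in\{-1,+1\}$ with uniform prior; agents $n=1,2,\dots$ act in sequence; agent $n$ privately observes $s_n\sim\mathcal{N}(\theta,\sigma^2)$, i.i.d. given $\theta$, $\sigma>0$, and has a private budget $\varepsilon_n\sim G$, independent across agents and of everything else. The public log-likelihood ratio is $l_n=\log\frac{\mathbb{P}(\theta=+1\mid x_1,\dots,x_{n-1})}{\mathbb{P}(\theta=-1\mid x_1,\dots,x_{n-1})}$, $l_1=0$, where $x_i$ are reported actions. With $t(l)=-\sigma^2l/2$, agent $n$'s intended action is $a_n=+1$ if $s_n>t(l_n)$, else $-1$; she reports $x_n=a_n$ with probability $1-u_n$ and $x_n=-a_n$ with probability $u_n=\frac12e^{-\varepsilon_n|s_n-t(l_n)|}$. The public, not observing $\varepsilon_n$, updates $l_{n+1}=l_n+\log\frac{\mathbb{P}(x_n\mid l_n,\theta=+1)}{\mathbb{P}(x_n\mid l_n,\theta=-1)}$, where these probabilities average over $s_n$ and $\varepsilon_n$. *)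

(* Defs.v *)
From HB Require Import structures.
From mathcomp Require Import all_boot all_order all_algebra.
From mathcomp Require Import all_classical all_reals all_analysis.
Set Implicit Arguments. Unset Strict Implicit. Unset Printing Implicit Defensive.
Import Order.TTheory GRing.Theory Num.Theory.
Import numFieldNormedType.Exports.
Local Open Scope classical_set_scope.
Local Open Scope ring_scope.

Section sequential_learning.
Context {R : realType}.

Definition mutually_independent d (T : measurableType d) (P : probability T R)
    (I : eqType) (X : I -> T -> R) : Prop :=
  forall (J : seq I) (B : I -> set R), uniq J ->
    (forall i, measurable (B i)) ->
    P (\big[setI/setT]_(i <- J) (X i @^-1` B i)) =
      (\prod_(i <- J) P (X i @^-1` B i))%E.

Definition threshold (sigma l : R) : R := - (sigma ^+ 2 * l) / 2.

Definition flip_prob (eps s t : R) : R := 2^-1 * expR (- (eps * `|s - t|)).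

Definition intended_action (s t : R) : R := if t < s then 1 else -1.

(* reported action: the intended action is flipped iff the auxiliary
   uniform[0,1] variable v falls below the flip probability, so that the
   flip happens with probability u. *)
Definition reported_action (sigma l s eps v : R) : R :=
  let t := threshold sigma l in
  if v < flip_prob eps s t then - intended_action s t else intended_action s t.

Definition prob_report_plus (sigma : R) (G : probability R R) (theta l : R) : R :=
  let t := threshold sigma l in
  fine (\int[G]_eps \int[normal_prob theta sigma]_s
          (if t < s then 1 - flip_prob eps s t else flip_prob eps s t)%:E)%E.

Definition prob_report (sigma : R) (G : probability R R) (x theta l : R) : R :=
  if x == 1 then prob_report_plus sigma G theta l
  else 1 - prob_report_plus sigma G theta l.

Definition llr_increment (sigma : R) (G : probability R R) (l x : R) : R :=
  ln (prob_report sigma G x 1 l / prob_report sigma G x (-1) l).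

(* Public LLR: pub_llr n is l_{n+1} of the paper (agents indexed from 0 here);
   pub_llr 0 = l_1 = 0. *)
Fixpoint pub_llr (T : Type) (sigma : R) (G : probability R R)
    (s eps v : nat -> T -> R) (w : T) (n : nat) : R :=
  match n with
  | 0 => 0
  | n'.+1 =>
    let l := pub_llr sigma G s eps v w n' in
    l + llr_increment sigma G l (reported_action sigma l (s n' w) (eps n' w) (v n' w))
  end.

Definition agent_family (T : Type) (s eps v : nat -> T -> R) :
    nat * 'I_3 -> T -> R :=
  fun i => match val i.2 with 0 => s i.1 | 1 => eps i.1 | _ => v i.1 end.

End sequential_learning.

(* Main.v *)
(* Averaging over the budget, the probability of the report +1 in state theta is
   the integral of a fixed increasing curve shifted by theta, so the two states
   differ by its increment over an interval of length 2. That increment is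
   O(1 / (1 + |l|)), because e exp (- e y) <= 1 / y, and at least a multiple of
   exp (- b |l|), because the budget is bounded and almost surely positive. The
   first bound makes every step away from 0 of size O(1 / (1 + |l|)), hence
   l ^ 2 grows by at most a constant per step, whatever the reports are: this is
   the sqrt n bound. For the log n bound, infinitely many wrong reports may
   occur, so one argues with the supermartingale M = exp (- l / 2): a Hellinger
   bound shows that one step multiplies it by at most 1 - c exp (- 2 b |l|) on
   average, and since exp (- l) is a martingale, its expectation decays
   polynomially in n. Doob's maximal inequality and Borel-Cantelli along the
   times N ^ j then give l_n > j for all n >= N ^ j, for all large j. *)

Require Import Defs.
From HB Require Import structures.
From mathcomp Require Import all_boot all_order all_algebra.
From mathcomp Require Import all_classical all_reals all_analysis.
From mathcomp Require Import measurable_realfun ring lra.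
Import Order.TTheory GRing.Theory Num.Theory.
Import numFieldNormedType.Exports.
Local Open Scope classical_set_scope.
Local Open Scope ring_scope.

(** * The report curve and its increments over intervals of length 2 *)

Section plus_curve.
Context {R : realType}.
Implicit Types a e x y : R.

(* The probability of the report +1 with budget [e] and signal [y] above the
   threshold. *)
Definition plus_curve e y : R :=
  if 0 < y then 1 - 2^-1 * expR (- (e * `|y|)) else 2^-1 * expR (- (e * `|y|)).

Lemma plus_curve_pos {e y} : 0 < y ->
  plus_curve e y = 1 - 2^-1 * expR (- (e * y)).
Proof. by move=> y0; rewrite /plus_curve y0 gtr0_norm. Qed.

Lemma plus_curve_neg {e y} : y <= 0 -> plus_curve e y = 2^-1 * expR (e * y).
Proof. by move=> y0; rewrite /plus_curve ltNge y0/= ler0_norm// mulrN opprK. Qed.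

(** Both branches equal 1/2 at 0, so the strict test in the definition does not spoil the symmetry.
    It transfers every estimate from the report +1 to the report -1. *)
Lemma plus_curveN e y : plus_curve e (- y) = 1 - plus_curve e y.
Proof.
have [y0|y0|->] := ltgtP y 0.
- by rewrite plus_curve_pos ?oppr_gt0// plus_curve_neg ?ltW// mulrN opprK.
- by rewrite plus_curve_neg ?oppr_le0 ?ltW// plus_curve_pos// mulrN subKr.
- by rewrite oppr0 plus_curve_neg// mulr0 expR0; lra.
Qed.

Lemma plus_curve_ge_half {e y} : 0 <= e -> 0 < y -> 2^-1 <= plus_curve e y.
Proof.
move=> e0 y0; rewrite plus_curve_pos//.
have : expR (- (e * y)) <= 1 by rewrite expR_le1 oppr_le0 mulr_ge0// ltW.
lra.
Qed.

Lemma plus_curve_ge0 e y : 0 <= e -> 0 <= plus_curve e y.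
Proof.
move=> e0; have [y0|y0] := ltP 0 y.
  by apply: le_trans (plus_curve_ge_half e0 y0); lra.
by rewrite plus_curve_neg// mulr_ge0 ?expR_ge0//; lra.
Qed.

Lemma plus_curve_le1 e y : 0 <= e -> plus_curve e y <= 1.
Proof.
by move=> e0; rewrite -subr_ge0 -plus_curveN plus_curve_ge0.
Qed.

(** Above 0 the curve is at least 1/2. At or below 0, [x <= y <= 0] gives [|y| <= |x|], and
    [e <= a]. The bound is free of [e], hence survives averaging over any budget law on [[0, a]]. *)
Lemma plus_curve_lower a e x y : 0 <= e <= a -> x <= y ->
  2^-1 * expR (- (a * `|x|)) <= plus_curve e y.
Proof.
move=> /andP[e0 ea] xy; have [y0|y0] := ltP 0 y.
  apply: le_trans (plus_curve_ge_half e0 y0).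
  rewrite ler_piMr//.
  by rewrite expR_le1 oppr_le0 mulr_ge0// (le_trans e0 ea).
rewrite plus_curve_neg// ler_pM2l; last lra.
rewrite ler_expR ler0_norm ?(le_trans xy)//; nra.
Qed.

(** On the exponential branch the ratio is exactly [expR (2 * e)]. The factor 2 covers the cases
    where the left side is only bounded by 1. This is what makes the jumps of the log-likelihood
    ratio bounded. *)
Lemma plus_curve_ratio a e y : 0 <= e <= a ->
  plus_curve e (y + 1) <= 2 * expR (2 * a) * plus_curve e (y - 1).
Proof.
move=> /andP[e0 ea].
have E1 : 1 <= expR (2 * a).
  by rewrite -expR0 ler_expR mulr_ge0// (le_trans e0 ea).
have [y1|y1] := ltP 0 (y - 1).
  have := plus_curve_ge_half e0 y1; have := plus_curve_le1 e (y + 1) e0.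
  nra.
rewrite [X in _ <= _ * X]plus_curve_neg//.
have [y2|y2] := ltP 0 (y + 1).
  apply: le_trans (plus_curve_le1 _ _ e0) _.
  rewrite mulrACA mulfV// mul1r -expRD leNgt expR_lt1 -leNgt.
  have := mulr_ge0 e0 (ltW y2); lra.
rewrite plus_curve_neg// mulrACA mulfV// mul1r -expRD.
rewrite (le_trans (y := expR (e * (y + 1))))//.
  rewrite ler_piMl ?expR_ge0//; lra.
rewrite ler_expR; nra.
Qed.

Definition curve_gap e y := plus_curve e (y + 1) - plus_curve e (y - 1).

Lemma curve_gapN e y : curve_gap e (- y) = curve_gap e y.
Proof.
rewrite /curve_gap (_ : - y + 1 = - (y - 1)); last ring.
rewrite (_ : - y - 1 = - (y + 1)); last ring.
by rewrite !plus_curveN; ring.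
Qed.

Lemma curve_gap_norm e y : curve_gap e y = curve_gap e `|y|.
Proof. by have [_|_] := ger0P y; rewrite ?curve_gapN. Qed.

Lemma curve_gap_far e y : 1 < y ->
  curve_gap e y = 2^-1 * expR (- (e * (y + 1))) * (expR (2 * e) - 1).
Proof.
move=> y1; rewrite /curve_gap !plus_curve_pos; [|lra|lra].
have -> : expR (- (e * (y - 1))) = expR (- (e * (y + 1))) * expR (2 * e).
  by rewrite -expRD; congr expR; ring.
by ring.
Qed.

(** By symmetry [y] may be taken nonnegative: beyond 1 the explicit formula applies, and up to 1 the
    two points lie on different sides of 0 or touch it. The factor [1 - expR (- e)] vanishes only at
    budget 0, which is why [G] must not charge 0. *)
Lemma curve_gap_lower a e y : 0 <= e <= a ->
  2^-1 * (1 - expR (- e)) * expR (- (a * (1 + `|y|))) <= curve_gap e y.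
Proof.
move=> /andP[e0 ea]; rewrite curve_gap_norm.
have e1 : expR (- e) <= 1 by rewrite expR_le1 oppr_le0.
have a0 := le_trans e0 ea; have y0 := normr_ge0 y; move: `|y| y0 => {}y y0.
have [y1|y1] := ltP 1 y.
  rewrite curve_gap_far// -mulrA -[leRHS]mulrA ler_pM2l; last lra.
  rewrite mulrC; apply: ler_pM; rewrite ?expR_ge0 ?subr_ge0//.
    rewrite ler_expR; nra.
  have := expR_ge1Dx (- e); have := expR_ge1Dx (2 * e); lra.
rewrite /curve_gap (plus_curve_neg (y := y - 1)) ?subr_le0// plus_curve_pos; last lra.
have h1 : expR (- (a * (1 + y))) <= 1 by rewrite expR_le1 oppr_le0 mulr_ge0//; lra.
have h2 : expR (e * (y - 1)) <= 1 by rewrite expR_le1; nra.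
have h3 : expR (- (e * (y + 1))) <= expR (- e) by rewrite ler_expR; nra.
have h4 := expR_ge0 (- (a * (1 + y))).
nra.
Qed.

Lemma curve_gap_ge0 e y : 0 <= e -> 0 <= curve_gap e y.
Proof.
move=> e0; apply: le_trans (curve_gap_lower e e y _); last by rewrite e0/=.
by rewrite !mulr_ge0 ?expR_ge0// subr_ge0 expR_le1 oppr_le0.
Qed.

Lemma curve_gap_le1 e y : 0 <= e -> curve_gap e y <= 1.
Proof.
move=> e0; have := plus_curve_ge0 e (y - 1) e0.
have := plus_curve_le1 e (y + 1) e0; rewrite /curve_gap; lra.
Qed.

(** The exponential decay has rate [e], which may be arbitrarily small; maximizing over [e] leaves
    only polynomial decay, uniform in the budget. *)
Lemma curve_gap_upper e y : 0 <= e -> curve_gap e y <= 3 / (1 + `|y|).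
Proof.
move=> e0; rewrite curve_gap_norm.
have := normr_ge0 y; move: `|y| => {}y y0.
have y10 : 0 < 1 + y by lra.
rewrite ler_pdivlMr//.
have [y2|y2] := leP y 2; first by have := curve_gap_le1 e y e0; nra.
rewrite curve_gap_far; last lra.
(* Factoring at the nearer point [y - 1] makes the bracket at most [2 * e], so the gap is at most
   [e * expR (- (e * (y - 1)))], hence at most [1 / (y - 1)]. For [y > 2] this is below
   [3 / (1 + y)]. *)
have -> : 2^-1 * expR (- (e * (y + 1))) * (expR (2 * e) - 1) =
    2^-1 * expR (- (e * (y - 1))) * (1 - expR (- (2 * e))).
  have -> : expR (- (e * (y - 1))) = expR (- (e * (y + 1))) * expR (2 * e).
    by rewrite -expRD; congr expR; ring.
  have BF : expR (2 * e) * expR (- (2 * e)) = 1 by rewrite -expRD subrr expR0.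
  by rewrite -[X in _ - X]BF; ring.
have h1 := expR_ge1Dx (- (2 * e)).
have h2 := expR_ge1Dx (e * (y - 1)).
have h3 : expR (- (e * (y - 1))) * (1 + e * (y - 1)) <= 1.
  by rewrite -[leRHS]expR0 -(subrr (e * (y - 1))) [expR (_ - _)]expRD
    [leRHS]mulrC ler_pM2l ?expR_gt0.
set E := expR (- (e * _)) in h3 *; set F := expR (- _) in h1 *.
have E0 : 0 <= E by exact: expR_ge0.
have h4 : E * e * (y - 1) <= 1 by nra.
have h5 : 2^-1 * E * (1 - F) <= E * e by nra.
have Ee : 0 <= E * e by nra.
nra.
Qed.

Lemma measurable_plus_curve d (T : measurableType d) (f g : T -> R) :
  measurable_fun setT f -> measurable_fun setT g ->
  measurable_fun setT (fun w => plus_curve (f w) (g w)).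
Proof.
move=> mf mg.
have mE : measurable_fun setT (fun w => 2^-1 * expR (- (f w * `|g w|))).
  apply: measurable_funM => //; apply: measurableT_comp => //.
  apply: measurableT_comp => //; apply: measurable_funM => //.
  exact: measurableT_comp.
apply: measurable_fun_if => //.
- exact: measurable_fun_ltr.
- exact/measurable_funTS/measurable_funB.
- exact: measurable_funTS.
Qed.

End plus_curve.

(** * Translation and tail of the normal law *)

Section normal_facts.
Context {R : realType}.

Lemma lebesgue_measure_translate (c : R) (A : set R) : measurable A ->
  pushforward lebesgue_measure
    ((fun x => x + c) : measurableTypeR R -> measurableTypeR R) A =
  lebesgue_measure A.
Proof.
move=> mA.
have mt : measurable_fun setT
    ((fun x => x + c) : measurableTypeR R -> measurableTypeR R).
  exact: measurable_funD.
apply/esym/lebesgue_measure_unique => //= _ [[x y]] _ <-.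
rewrite /pushforward.
have -> : (fun z => z + c) @^-1` `]x, y] = `](x - c), (y - c)]%classic.
  by apply/funext => z /=; rewrite !in_itv/= ltrBlDr lerBrDr.
by rewrite !lebesgue_measure_itv/= !lte_fin ltrD2r -!EFinB opprB addrA subrK.
Qed.

Lemma normal_prob_shift (m s : R) (A : set R) : measurable A ->
  s != 0 ->
  normal_prob m s A = pushforward (normal_prob 0 s)
    ((fun x => x + m) : measurableTypeR R -> measurableTypeR R) A.
Proof.
move=> mA s0.
have mm : measurable_fun setT
    ((fun x => x + m) : measurableTypeR R -> measurableTypeR R).
  exact: measurable_funD.
have mf : measurable_fun setT (EFin \o normal_pdf m s).
  by apply/measurable_EFinP; exact: measurable_normal_pdf.
rewrite /pushforward /normal_prob.
transitivity (\int[pushforward lebesgue_measure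
    ((fun x => (x + m)%R) : measurableTypeR R -> measurableTypeR R)]_(x in A)
  (normal_pdf m s x)%:E)%E.
  apply: eq_measure_integral => B mB _; exact/esym/lebesgue_measure_translate.
rewrite ge0_integral_pushforward//; last 2 first.
  exact: measurable_funTS.
  by move=> x _; rewrite lee_fin normal_pdf_ge0.
apply: eq_integral => x _ /=.
by rewrite !normal_pdfE// /normal_fun addrK subr0.
Qed.

(** Moves the state from the law into the integrand, so that both states are integrated against one
    centred law. *)
Lemma integral_normal_shift (m s : R) (g : measurableTypeR R -> \bar R) :
  s != 0 -> measurable_fun setT g -> (forall x, 0 <= g x)%E ->
  (\int[normal_prob m s]_x g x = \int[normal_prob 0%R s]_x g (x + m)%R)%E.
Proof.
move=> s0 mg g0.
have mm : measurable_fun setT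
    ((fun x => x + m) : measurableTypeR R -> measurableTypeR R).
  exact: measurable_funD.
transitivity (\int[pushforward (normal_prob 0 s)
    ((fun x => (x + m)%R) : measurableTypeR R -> measurableTypeR R)]_x g x)%E.
  by apply: eq_measure_integral => B mB _; exact: normal_prob_shift.
by rewrite ge0_integral_pushforward.
Qed.

(* On [r <= |x|] the density with deviation [s] is at most [C / r ^ 2] times the
   density with deviation [2 s], because [u <= expR u]. *)
Lemma normal_prob_tail (s : R) : 0 < s -> exists2 C : R, 0 < C &
  forall r, 0 < r ->
    (normal_prob 0%R s [set x | (r <= `|x|)%R] <= (C / r ^+ 2)%:E)%E.
Proof.
move=> s0; have sn0 : s != 0 by rewrite gt_eqF.
have t0 : 2 * s != 0 by rewrite mulf_neq0.
have p1 := normal_peak_gt0 sn0; have p2 := normal_peak_gt0 t0.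
pose C := normal_peak s / normal_peak (2 * s) * (8 / 3 * s ^+ 2).
have C0 : 0 < C.
  by rewrite /C mulr_gt0 ?divr_gt0// mulr_gt0 ?exprn_gt0// divr_gt0.
exists C => // r r0.
have mA : measurable [set x : R | r <= `|x|].
  rewrite -[X in measurable X]setTI.
  exact: (measurable_fun_ler (measurable_cst r) (@normr_measurable R setT)).
have C1 : 0 <= C / r ^+ 2 by rewrite divr_ge0 ?exprn_ge0// ltW.
apply: (@le_trans _ _
  ((C / r ^+ 2)%:E * normal_prob 0%R (2 * s) [set x | (r <= `|x|)%R])%E).
  rewrite /normal_prob -ge0_integralZl//=; last 2 first.
    by apply/measurable_funTS/measurable_EFinP; exact: measurable_normal_pdf.
    by move=> x _; rewrite lee_fin normal_pdf_ge0.
  apply: ge0_le_integral => //=.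
  - by move=> x _; rewrite lee_fin normal_pdf_ge0.
  - by apply/measurable_funTS/measurable_EFinP; exact: measurable_normal_pdf.
  - apply/measurable_funTS/measurable_EFinP/measurable_funM => //.
    exact: measurable_normal_pdf.
  move=> x rx; rewrite lee_fin !normal_pdfE// /normal_fun !subr0.
  (* [u] is the difference of the two Gaussian exponents, since 1/2 - 1/8 = 3/8. *)
  set u := 3 / 8 * (x ^+ 2 / s ^+ 2).
  have -> : expR (- x ^+ 2 / ((2 * s) ^+ 2 *+ 2)) =
      expR u * expR (- x ^+ 2 / (s ^+ 2 *+ 2)).
    rewrite -expRD; congr expR; rewrite /u; field.
    by rewrite sn0/=.
  rewrite !mulrA ler_pM2r ?expR_gt0//.
  have ur : 1 <= 8 / 3 * s ^+ 2 / r ^+ 2 * u.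
    have -> : 8 / 3 * s ^+ 2 / r ^+ 2 * u = x ^+ 2 / r ^+ 2.
      by rewrite /u; field; rewrite sn0 gt_eqF.
    rewrite ler_pdivlMr ?exprn_gt0// mul1r -[leRHS]real_normK ?num_real//.
    by rewrite ler_pXn2r// nnegrE ltW.
  have ue : u <= expR u by have := expR_ge1Dx u; lra.
  have -> : C / r ^+ 2 * normal_peak (2 * s) * expR u =
      normal_peak s * (8 / 3 * s ^+ 2 / r ^+ 2 * expR u).
    by rewrite /C; field; rewrite !gt_eqF// exprn_gt0.
  rewrite ler_peMr ?(ltW p1)//; apply: (le_trans ur); rewrite ler_wpM2l//.
  by rewrite divr_ge0 ?exprn_ge0 ?(ltW r0)// mulr_ge0 ?exprn_ge0 ?(ltW s0)// divr_ge0.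
rewrite -[leRHS]mule1; apply: lee_wpmul2l; rewrite ?lee_fin//.
exact: probability_le1.
Qed.

End normal_facts.

(** * Integrals of bounded and of positive functions *)

Section probability_integrals.
Context {d} {T : measurableType d} {R : realType} {Q : probability T R}.
Implicit Types f : T -> R.

Lemma bounded_integrable {f} (M : R) : measurable_fun setT f ->
  (forall x, `|f x| <= M) -> Q.-integrable setT (EFin \o f).
Proof.
move=> mf fM; apply: measurable_bounded_integrable => //.
  by rewrite -ge0_fin_numE// fin_num_measure.
exists M; split; first exact: num_real.
by move=> x Mx y _; exact: le_trans (fM y) (ltW Mx).
Qed.

Lemma Rintegral_prob_cst (r : R) : \int[Q]_x r = r.
Proof.
rewrite Rintegral_cst// [X in fine X](_ : _ = 1%E) ?mulr1//; exact: probability_setT.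
Qed.

(** If the integral were 0, [f] would vanish almost everywhere, and a null zero set would then force
    the whole space to be null. *)
Lemma Rintegral_gt0 {f} : Q.-integrable setT (EFin \o f) ->
  (forall x, 0 <= f x) -> Q [set x | f x = 0] = 0%E ->
  0 < \int[Q]_x f x.
Proof.
move=> fi f0 Qf0; rewrite lt_def Rintegral_ge0// andbT; apply/eqP => I0.
have mf : measurable_fun setT (EFin \o f) by exact: (measurable_int Q).
have IE : (\int[Q]_x (f x)%:E = 0)%E.
  rewrite -[LHS]fineK ?[fine _]I0//; exact: integrable_fin_num.
have /ae_eq_integral_abs : (\int[Q]_x `|(EFin \o f) x| = 0)%E.
  rewrite -[RHS]IE; apply: eq_integral => x _ /=.
  by rewrite ger0_norm.
move=> /(_ measurableT mf)[N [mN QN sN]].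
have : (Q setT <= Q [set x | f x = 0%R] + Q N)%E.
  have mZ : measurable [set x | f x = 0].
    rewrite -[X in measurable X]setTI -[X in _ `&` X]/(f @^-1` [set 0]).
    by move/measurable_EFinP : mf; apply.
  apply: le_trans (measureU2 _ _ _) => //.
  rewrite le_measure ?inE//; first exact: measurableU.
  move=> x _; have [fx|fx] := pselect (f x = 0); [by left|right].
  by apply: sN => /= h; apply: fx; have := h I => -[].
by rewrite Qf0 QN adde0 probability_setT lee_fin ler10.
Qed.

End probability_integrals.

(** * The law of a single report *)

Section report_law.
Context {R : realType}.
Implicit Types a e l c : R.

(* The budget lies in [0, a] only almost surely; after clipping, the bounds on
   [plus_curve] hold everywhere and leave the integrals unchanged. *)
Definition clip a e : R := Num.min a (Num.max 0 e).

Lemma clip_itv a e : 0 <= a -> 0 <= clip a e <= a.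
Proof. by move=> a0; rewrite /clip le_min a0 le_max lexx ge_min lexx. Qed.

Lemma clip_id a e : 0 <= e <= a -> clip a e = e.
Proof. by move=> /andP[e0 ea]; rewrite /clip max_r// min_r. Qed.

Lemma clip_gt0 a e : 0 < a -> (0 < clip a e) = (0 < e).
Proof. by move=> a0; rewrite /clip lt_min a0 lt_max ltxx. Qed.

Lemma measurable_clip d (T : measurableType d) a (f : T -> R) :
  measurable_fun setT f -> measurable_fun setT (fun w => clip a (f w)).
Proof.
by move=> mf; apply: measurable_minr => //; apply: measurable_maxr.
Qed.

Lemma report_curveE e x t :
  (if t < x then 1 - flip_prob e x t else flip_prob e x t) = plus_curve e (x - t).
Proof. by rewrite /plus_curve subr_gt0. Qed.

(** For negative [e] the integrand is unbounded and changes sign, so Tonelli is applied to its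
    positive and negative parts separately. *)
Lemma measurable_integral_curve (G : probability R R) (m sigma t : R) :
  measurable_fun setT
    (fun e => \int[normal_prob m sigma]_x (plus_curve e (x - t))%:E)%E.
Proof.
pose f (z : R * measurableTypeR R) : \bar R := (plus_curve z.1 (z.2 - t))%:E.
have mf : measurable_fun setT f.
  apply/measurable_EFinP; apply: measurable_plus_curve => //.
  by apply: measurable_funB => //; exact: measurable_snd.
have -> : (fun e => \int[normal_prob m sigma]_x (plus_curve e (x - t))%:E)%E =
    (fun e => fubini_F (normal_prob m sigma) f^\+ e -
              fubini_F (normal_prob m sigma) f^\- e)%E.
  apply/funext => e; rewrite integralE /fubini_F; congr (_ - _)%E;
    by apply: eq_integral => x _; rewrite ?funeposE ?funenegE.
apply: emeasurable_funB; apply: measurable_fun_fubini_tonelli_F => //.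
  exact: measurable_funepos.
exact: measurable_funeneg.
Qed.

(** Shifting the signal by [theta] turns the iterated integral into one over a product law that is
    the same for both states. Clipping alters the inner integral only for budgets outside [[0, a]],
    a null set of [G]. *)
Lemma prob_report_plusE a (sigma : R) (G : probability R R) (theta l : R) :
  0 < sigma -> 0 <= a -> G (~` `[0, a]) = 0%E ->
  prob_report_plus sigma G theta l =
  \int[(G \x normal_prob 0%R sigma)%E]_z
    plus_curve (clip a z.1) (theta + z.2 + sigma ^+ 2 * l / 2).
Proof.
move=> s0 a0 Ga; rewrite /prob_report_plus /Rintegral; congr fine.
pose f (z : R * measurableTypeR R) : \bar R :=
  (plus_curve (clip a z.1) (theta + z.2 + sigma ^+ 2 * l / 2))%:E.
have mf : measurable_fun setT f.
  apply/measurable_EFinP; apply: measurable_plus_curve.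
    exact: measurable_clip.
  by do 2 apply: measurable_funD => //; exact: measurable_snd.
have f0 z : (0 <= f z)%E.
  by rewrite lee_fin plus_curve_ge0//; have /andP[] := clip_itv a z.1 a0.
rewrite [RHS](fubini_tonelli1 (m1 := G) (m2 := normal_prob 0 sigma) f mf f0).
transitivity (\int[G]_e \int[normal_prob theta sigma]_x
    (plus_curve e (x - threshold sigma l))%:E)%E.
  by apply: eq_integral => e _; apply: eq_integral => x _; rewrite report_curveE.
apply: ae_eq_integral => //.
- exact: measurable_integral_curve.
- exact: measurable_fun_fubini_tonelli_F.
exists (~` `[0, a]); split => //; first exact: measurableC.
move=> e /= ne ea; apply: ne => _; rewrite /fubini_F.
rewrite integral_normal_shift ?gt_eqF//.
- apply: eq_integral => x _; rewrite /f /= clip_id; last by move: ea; rewrite in_itv.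
  by congr (plus_curve _ _)%:E; rewrite /threshold; field.
- apply/measurable_EFinP; apply: measurable_plus_curve => //.
  exact: measurable_funB.
- move=> x; rewrite lee_fin plus_curve_ge0//.
  by move: ea; rewrite in_itv/= => /andP[].
Qed.

Lemma uniform_prob_lt c : 0 <= c <= 1 ->
  uniform_prob (@ltr01 R) [set x | (x < c)%R] = c%:E.
Proof.
move=> /andP[c0 c1]; rewrite /uniform_prob integral_uniform_pdf.
have -> : [set x : R | x < c] `&` `[0, 1] = `[0, c[%classic.
  apply/seteqP; split=> x /=; rewrite !in_itv/=.
    by move=> [-> /andP[-> _]].
  by move=> /andP[-> xc]; split => //=; exact: le_trans (ltW xc) c1.
rewrite (eq_integral (cst 1%E)); last first.
  move=> x; rewrite inE/= in_itv/= => /andP[x0 xc].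
  by rewrite /uniform_pdf x0 (le_trans (ltW xc) c1)/= subr0 invr1.
rewrite integral_cst//= mul1e lebesgue_measure_itv/= lte_fin.
by case: ltP => c0'; rewrite ?oppr0 ?adde0//; congr EFin; apply/eqP; rewrite eq_le c0.
Qed.

Lemma reported_action_or (sigma l x e v : R) :
  reported_action sigma l x e v = 1 \/ reported_action sigma l x e v = -1.
Proof.
rewrite /reported_action /intended_action.
by case: ifP => _; case: ifP => _; rewrite ?opprK; auto.
Qed.

Lemma reported_action1E (sigma l x e v : R) :
  (reported_action sigma l x e v == 1) =
  (if threshold sigma l < x
   then ~~ (v < flip_prob e x (threshold sigma l))
   else v < flip_prob e x (threshold sigma l)).
Proof.
rewrite /reported_action /intended_action.
have n1 : (-1 == 1 :> R) = false by apply/negP => /eqP; lra.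
by case: ifP => _; case: ifP => _; rewrite ?opprK ?eqxx ?n1.
Qed.

Definition plus_report_set (sigma l : R) :
    set (R * (measurableTypeR R * measurableTypeR R)) :=
  [set z | reported_action sigma l z.2.1 z.1 z.2.2 = 1].

Lemma measurable_plus_report_set sigma l : measurable (plus_report_set sigma l).
Proof.
pose b (z : R * (measurableTypeR R * measurableTypeR R)) :=
  reported_action sigma l z.2.1 z.1 z.2.2 == 1.
have -> : plus_report_set sigma l = setT `&` b @^-1` [set true].
  by rewrite setTI; apply/funext => z; apply/propext; split => /eqP.
suff mb : measurable_fun setT b by exact: mb.
rewrite /b; under eq_fun do rewrite reported_action1E.
have m1 : measurable_fun setT
    (fun z : R * (measurableTypeR R * measurableTypeR R) => z.2.1 : R).
  exact: measurableT_comp measurable_fst measurable_snd.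
have m2 : measurable_fun setT
    (fun z : R * (measurableTypeR R * measurableTypeR R) => z.2.2 : R).
  exact: measurableT_comp measurable_snd measurable_snd.
have mflip : measurable_fun setT
    (fun z : R * (measurableTypeR R * measurableTypeR R) =>
      z.2.2 < flip_prob z.1 z.2.1 (threshold sigma l)).
  apply: measurable_fun_ltr => //; apply: measurable_funM => //.
  apply: measurableT_comp => //; apply: measurableT_comp => //.
  apply: measurable_funM => //; apply: measurableT_comp => //.
  exact: measurable_funB.
apply: measurable_fun_if => //.
- exact: measurable_fun_ltr.
- exact/measurable_funTS/measurable_neg.
- exact: measurable_funTS.
Qed.

(** Signal in state +1, paired with the uniform variable that decides the flip. *)
Definition signal_noise_law (sigma : R) :
    probability (measurableTypeR R * measurableTypeR R)%type R :=
  (normal_prob 1%R sigma \x uniform_prob (@ltr01 R))%E.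

Definition agent_law (sigma : R) (G : probability R R) :
    probability (R * (measurableTypeR R * measurableTypeR R))%type R :=
  (G \x signal_noise_law sigma)%E.

(** For a nonnegative budget the flip probability lies in [[0, 1]], so the uniform variable falls
    below it with exactly that probability. Thus the probability used by the public is the true one
    in state +1. *)
Lemma plus_report_set_prob a (sigma l : R) (G : probability R R) :
  0 < sigma -> G (~` `[0, a]) = 0%E ->
  agent_law sigma G (plus_report_set sigma l) =
  (prob_report_plus sigma G 1 l)%:E.
Proof.
move=> s0 Ga.
have mD := measurable_plus_report_set sigma l.
suff E : agent_law sigma G (plus_report_set sigma l) = (\int[G]_e \int[normal_prob 1 sigma]_s
     (if threshold sigma l < s then 1 - flip_prob e s (threshold sigma l)
      else flip_prob e s (threshold sigma l))%:E)%E.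
  rewrite /prob_report_plus -E fineK//.
  exact: (fin_num_measure (agent_law sigma G)).
rewrite /agent_law /= /product_measure1.
under [RHS]eq_integral => e _ do
  under eq_integral => x _ do rewrite report_curveE.
apply: ae_eq_integral => //.
- exact: (@measurable_fun_xsection _ _ _ _ _ (signal_noise_law sigma) _ mD).
- exact: measurable_integral_curve.
exists (~` `[0, a]); split => //; first exact: measurableC.
move=> e /= ne ea; apply: ne => _; apply: eq_integral => x _ /=.
have e0 : 0 <= e by move: ea; rewrite in_itv/= => /andP[].
set c := flip_prob e x (threshold sigma l).
have c01 : 0 <= c <= 1.
  have : expR (- (e * `|x - threshold sigma l|)) <= 1.
    by rewrite expR_le1 oppr_le0 mulr_ge0.
  have := expR_ge0 (- (e * `|x - threshold sigma l|)).
  by rewrite /c /flip_prob; set E := expR _ => *; apply/andP; split; lra.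
have -> : xsection (xsection (plus_report_set sigma l) e) x =
    [set v | if threshold sigma l < x then ~~ (v < c) else v < c].
  apply/funext => v; rewrite /xsection/= !inE /plus_report_set/=.
  rewrite -reported_action1E; apply/propext.
  by split => [/set_mem/eqP|/eqP h]; last exact/mem_set.
rewrite -report_curveE -/c; case: ifPn => _.
  have -> : [set v | ~~ (v < c)] = ~` [set v | v < c].
    by apply/funext => v; apply/propext; split => /negP.
  rewrite probability_setC; last first.
    rewrite -[X in measurable X]setTI.
    by apply: (measurable_fun_ltr (g := cst c)).
  by rewrite EFinB; congr (_ - _)%E; exact: uniform_prob_lt.
exact: uniform_prob_lt.
Qed.

End report_law.

(** * The analytic interface between the report law and the belief chain *)

Set Implicit Arguments.
(** [p] and [m] stand for the probabilities of the report +1 in the states +1 and -1. The two floors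
    keep the denominators of the likelihood ratios away from 0 exactly for the reports that push [l]
    further from 0. *)
Record report_bounds {R : realType} (p m : R -> R) (K C c b c0 : R) : Prop :=
  ReportBounds {
  rb_K : 1 < K;
  rb_C : 0 < C;
  rb_c : 0 < c;
  rb_b : 0 < b;
  rb_c0 : 0 < c0;
  rb_m_gt0 : forall l, 0 < m l;
  rb_p_lt1 : forall l, p l < 1;
  rb_gap_lower : forall l, c * expR (- (b * `|l|)) <= p l - m l;
  rb_gap_upper : forall l, p l - m l <= C / (1 + `|l|);
  rb_ratio : forall l, p l <= K * m l;
  rb_ratioC : forall l, 1 - m l <= K * (1 - p l);
  rb_floor : forall l, 0 <= l -> c0 <= m l;
  rb_floorC : forall l, l <= 0 -> c0 <= 1 - p l }.
Unset Implicit Arguments.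

(** * The bounds hold for the Gaussian model *)

Section report_estimates.
Context {R : realType} (sigma a : R) (G : probability R R).
Hypotheses (sigma_gt0 : 0 < sigma) (a_gt0 : 0 < a).
Hypotheses (Ga : G (~` `[0, a]) = 0%E) (G0 : G [set 0] = 0%E).

Local Notation Z := (R * measurableTypeR R)%type.

Let Q : probability (R * measurableTypeR R)%type R :=
  (G \x normal_prob 0%R sigma)%E.
Let curve (f : Z -> R) : R :=
  \int[Q]_z plus_curve (clip a z.1) (f z).
(** The threshold is [- (k * l)], so the signal lies above it by noise plus [k * l] plus or minus 1,
    according to the state. *)
Let k : R := sigma ^+ 2 / 2.

Let k_gt0 : 0 < k. Proof. by rewrite divr_gt0// exprn_gt0. Qed.

Let clipP (z : Z) : 0 <= clip a z.1 <= a.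
Proof. exact: clip_itv (ltW a_gt0). Qed.

Let clip_ge0 (z : Z) : 0 <= clip a z.1.
Proof. by have /andP[] := clipP z. Qed.

Let measurable_noise (t : R) :
  measurable_fun setT (fun z : Z => z.2 + t).
Proof. by apply: measurable_funD => //; exact: measurable_snd. Qed.

Let measurable_curve (f : Z -> R) : measurable_fun setT f ->
  measurable_fun setT (fun z : Z => plus_curve (clip a z.1) (f z)).
Proof. by move=> mf; apply: measurable_plus_curve => //; exact: measurable_clip. Qed.

Let integrable_curve (f : Z -> R) : measurable_fun setT f ->
  Q.-integrable setT (EFin \o (fun z : Z => plus_curve (clip a z.1) (f z))).
Proof.
move=> mf; apply: (bounded_integrable 1); first exact: measurable_curve.
by move=> z; rewrite ger0_norm ?plus_curve_ge0 ?plus_curve_le1.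
Qed.

Let integrable_expR_norm t (r : R) : 0 <= r ->
  Q.-integrable setT (EFin \o (fun z : Z => r * expR (- (a * `|z.2 + t|)))).
Proof.
move=> r0; apply: (bounded_integrable r).
  apply: measurable_funM => //; apply: measurableT_comp => //.
  apply: measurableT_comp => //; apply: measurable_funM => //.
  exact: measurableT_comp.
move=> z; rewrite ger0_norm ?mulr_ge0 ?expR_ge0// ler_piMr//.
by rewrite expR_le1 oppr_le0 mulr_ge0// ltW.
Qed.

Let level t : R := \int[Q]_z (2^-1 * expR (- (a * `|z.2 + t|))).

Let level_gt0 t : 0 < level t.
Proof.
apply: Rintegral_gt0; first by apply: integrable_expR_norm; rewrite invr_ge0.
  by move=> z; rewrite mulr_ge0 ?expR_ge0 ?invr_ge0.
rewrite (_ : [set _ | _] = set0) ?measure0//.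
by apply/seteqP; split=> z //= /eqP; rewrite gt_eqF// mulr_gt0 ?expR_gt0 ?invr_gt0.
Qed.

Let level_le t (f : Z -> R) : measurable_fun setT f -> (forall z, z.2 + t <= f z) ->
  level t <= curve f.
Proof.
move=> mf tf; apply: le_Rintegral => //.
- by apply: integrable_expR_norm; rewrite invr_ge0.
- exact: integrable_curve.
- by move=> z _; exact: plus_curve_lower.
Qed.

Let curveN (f : Z -> R) : measurable_fun setT f -> 1 - curve f = curve (fun z => - f z).
Proof.
move=> mf; rewrite /curve.
have -> : 1 = \int[Q]_z 1 :> R.
  exact/esym/Rintegral_prob_cst.
rewrite -RintegralB//; last 2 first.
- by apply: (bounded_integrable 1) => // z; rewrite normr1.
- exact: integrable_curve.
by apply: eq_Rintegral => z _; rewrite plus_curveN.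
Qed.

Let levelC_le t (f : Z -> R) : measurable_fun setT f ->
  (forall z, f z <= z.2 + t) -> level t <= 1 - curve f.
Proof.
move=> mf tf; rewrite curveN//; apply: le_Rintegral => //.
- by apply: integrable_expR_norm; rewrite invr_ge0.
- by apply: integrable_curve; exact: measurableT_comp.
- by move=> z _; rewrite -normrN; apply: plus_curve_lower; rewrite ?lerN2.
Qed.

Let p l := prob_report_plus sigma G 1 l.
Let m l := prob_report_plus sigma G (-1) l.

Let pE l : p l = curve (fun z => z.2 + k * l + 1).
Proof.
rewrite /p (prob_report_plusE a) ?ltW//; apply: eq_Rintegral => z _.
by congr (plus_curve _ _); rewrite /k; field.
Qed.

Let mE l : m l = curve (fun z => z.2 + k * l - 1).
Proof.
rewrite /m (prob_report_plusE a) ?ltW//; apply: eq_Rintegral => z _.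
by congr (plus_curve _ _); rewrite /k; field.
Qed.

Let mf1 l (t : R) :
  measurable_fun setT (fun z : Z => z.2 + k * l + t).
Proof. by apply: measurable_funD => //. Qed.

Let gapE l : p l - m l = \int[Q]_z curve_gap (clip a z.1) (z.2 + k * l).
Proof. by rewrite pE mE -RintegralB//; exact: integrable_curve. Qed.

Let measurable_gap t :
  measurable_fun setT (fun z : Z => curve_gap (clip a z.1) (z.2 + t)).
Proof.
by apply: measurable_funB; apply: measurable_curve; exact: measurable_funD.
Qed.

Let integrable_gap t :
  Q.-integrable setT (EFin \o (fun z : Z => curve_gap (clip a z.1) (z.2 + t))).
Proof.
apply: (bounded_integrable 1) => // z.
by rewrite ger0_norm ?curve_gap_ge0 ?curve_gap_le1.
Qed.

(** The factor of the lower bound on the gap that is free of [l], once the triangle inequality has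
    split off [expR (- (a * k * |l|))]. *)
Let weight (z : Z) : R :=
  2^-1 * (1 - expR (- clip a z.1)) * expR (- (a * (1 + `|z.2|))).

Let clip_exp_le1 (z : Z) : expR (- clip a z.1) <= 1.
Proof. by rewrite expR_le1 oppr_le0. Qed.

Let weight_ge0 (z : Z) : 0 <= weight z.
Proof. by rewrite !mulr_ge0 ?expR_ge0 ?invr_ge0 ?subr_ge0. Qed.

Let integrable_weight : Q.-integrable setT (EFin \o weight).
Proof.
apply: (bounded_integrable 1).
  apply: measurable_funM.
    apply: measurable_funM => //; apply: measurable_funB => //.
    apply: measurableT_comp => //; apply: measurableT_comp => //.
    exact: measurable_clip.
  apply: measurableT_comp => //; apply: measurableT_comp => //.
  apply: measurable_funM => //; apply: measurable_funD => //.
  by apply: measurableT_comp => //; exact: measurable_snd.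
move=> z; rewrite ger0_norm// /weight.
have := clip_exp_le1 z; have := expR_ge0 (- clip a z.1).
have : expR (- (a * (1 + `|z.2|))) <= 1.
  by rewrite expR_le1 oppr_le0 mulr_ge0 ?addr_ge0// ltW.
have := expR_ge0 (- (a * (1 + `|z.2|))).
move: (expR _) (expR _) => x y x0 x1 y0 y1.
have xy := mulr_ge0 x0 y0; nra.
Qed.

Let measurable_le0 : measurable [set e : R | e <= 0].
Proof.
rewrite -[X in measurable X]setTI.
exact: (measurable_fun_ler (f := id) (g := cst 0)).
Qed.

Let G_le0 : G [set e | e <= 0] = 0%E.
Proof.
apply/eqP; rewrite eq_le measure_ge0 andbT.
apply: (@le_trans _ _ (G (~` `[0, a] `|` [set 0]))).
  rewrite le_measure ?inE//; first by apply: measurableU => //; exact: measurableC.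
  move=> e /= e0; have [->|en] := eqVneq e 0; first by right.
  by left => /=; rewrite in_itv/= => /andP[e0' _]; move/negP: en; apply; rewrite eq_le e0.
rewrite (le_trans (measureU2 _ _ _))//; first exact: measurableC.
by rewrite [X in (X + _)%E]Ga [X in (_ + X)%E]G0 adde0.
Qed.

(** The weight vanishes only where the clipped budget is 0, that is for budgets at most 0, and these
    have [G]-measure 0. *)
Let weight_int_gt0 : 0 < \int[Q]_z weight z.
Proof.
apply: Rintegral_gt0 => //; apply/eqP; rewrite eq_le measure_ge0 andbT.
apply: (@le_trans _ _ (Q ([set e | e <= 0] `*` setT))); last first.
  rewrite [Q _](product_measure1E G (normal_prob 0 sigma))//.
  by rewrite [X in (X * _)%E]G_le0 mul0e.
apply: le_measure; rewrite ?inE.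
- have /measurable_EFinP mw := measurable_int _ integrable_weight.
  by rewrite -[X in measurable X]setTI -[X in _ `&` X]/(weight @^-1` [set 0]); exact: mw.
- exact: measurableX.
move=> z /= /eqP; rewrite !mulf_eq0 (gt_eqF (expR_gt0 _)) orbF invr_eq0.
rewrite pnatr_eq0/= subr_eq0 => /eqP h; split => //=.
rewrite leNgt -(clip_gt0 _ _ a_gt0) -leNgt -oppr_ge0 leNgt -expR_lt1 -h.
by rewrite ltxx.
Qed.

Let gap_lower l :
  (\int[Q]_z weight z) * expR (- (a * k * `|l|)) <= p l - m l.
Proof.
rewrite gapE -RintegralZr//; apply: le_Rintegral => //.
  apply: (bounded_integrable 1).
    apply: measurable_funM => //.
    by have /measurable_EFinP := measurable_int _ integrable_weight.
  move=> z; rewrite ger0_norm; last first.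
    by apply: mulr_ge0; [exact: weight_ge0|exact: expR_ge0].
  have h1 : expR (- (a * k * `|l|)) <= 1.
    by rewrite expR_le1 oppr_le0 !mulr_ge0// ltW.
  have h2 : weight z <= 1.
    rewrite /weight.
    have := clip_exp_le1 z; have := expR_ge0 (- clip a z.1).
    have : expR (- (a * (1 + `|z.2|))) <= 1.
      by rewrite expR_le1 oppr_le0 mulr_ge0 ?addr_ge0// ltW.
    have := expR_ge0 (- (a * (1 + `|z.2|))).
    move: (expR _) (expR _) => x y x0 x1 y0 y1.
    have xy := mulr_ge0 x0 y0; nra.
  by rewrite -[leRHS]mulr1; apply: ler_pM => //; exact: expR_ge0.
move=> z _; have := curve_gap_lower _ _ (z.2 + k * l) (clipP z).
apply: le_trans.
rewrite /weight -[leLHS]mulrA -expRD ler_wpM2l//.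
  by rewrite mulr_ge0 ?invr_ge0 ?subr_ge0.
rewrite ler_expR -opprD lerN2 -mulrA -mulrDr ler_pM2l// -addrA lerD2l.
by rewrite (le_trans (ler_normD _ _))// lerD2l normrM gtr0_norm.
Qed.

Let gap_le1 l : p l - m l <= 1.
Proof.
rewrite gapE -[leRHS](_ : \int[Q]_z 1 = 1 :> R); last first.
  exact: Rintegral_prob_cst.
apply: le_Rintegral => //.
- by apply: (bounded_integrable 1) => // z; rewrite normr1.
- by move=> z _; exact: curve_gap_le1.
Qed.

(** The noise is cut at size [r], half of the shift [k * |l|]. Larger noise is rare by the tail
    bound, and there the gap is at most 1; for smaller noise the curve is evaluated at distance more
    than [r] from 0, where the gap is at most [3 / r]. *)
Let gap_upper : exists2 C : R, 0 < C & forall l, p l - m l <= C / (1 + `|l|).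
Proof.
have [D D0 DP] := normal_prob_tail _ sigma_gt0.
(* The 2 settles [|l| <= 1], where the gap is at most 1. For [|l| > 1] the bound is
   [4 * D / k ^+ 2 / |l| ^+ 2 + 6 / k / |l|], and [1 + |l|] is at most twice [|l|] and twice
   [|l| ^+ 2], which doubles both coefficients. *)
exists (2 + (8 * D / k ^+ 2 + 12 / k)).
  by rewrite !addr_gt0// divr_gt0 ?mulr_gt0 ?exprn_gt0.
move=> l; have l0 := normr_ge0 l; rewrite ler_pdivlMr ?ltr_pwDl//.
have Ck : 0 <= 8 * D / k ^+ 2 + 12 / k.
  by rewrite addr_ge0// divr_ge0 ?mulr_ge0 ?exprn_ge0 ?ltW.
have [l1|l1] := leP `|l| 1; first by have := gap_le1 l; nra.
have lp : 0 < `|l| by lra.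
pose r := k * `|l| / 2.
have r0 : 0 < r by rewrite divr_gt0// mulr_gt0.
pose A := [set z : Z | r <= `|z.2|].
have AE : A = setT `*` [set x | r <= `|x|].
  by apply/seteqP; split => z //= [].
have mA2 : measurable ([set x | r <= `|x|] : set (measurableTypeR R)).
  rewrite -[X in measurable X]setTI.
  exact: (measurable_fun_ler (measurable_cst r) (@normr_measurable R setT)).
have mA : measurable A by rewrite AE; exact: measurableX.
have QA : fine (Q A) <= D / r ^+ 2.
  rewrite -lee_fin fineK ?fin_num_measure// AE.
  rewrite [Q _](product_measure1E G (normal_prob 0 sigma))//.
  rewrite [X in (X * _)%E]probability_setT mul1e; exact: DP.
have iA : Q.-integrable setT (EFin \o (\1_A : _ -> R)).
  apply: (bounded_integrable 1); first exact: measurable_indic.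
  by move=> z; rewrite indicE; case: (_ \in _); rewrite ?normr1 ?normr0.
have ic (x : R) : Q.-integrable setT (EFin \o cst x).
  exact: (bounded_integrable (`|x|)).
have gl : p l - m l <= D / r ^+ 2 + 3 / r.
  rewrite gapE.
  apply: (@le_trans _ _ (\int[Q]_z ((\1_A z : R) + cst (3 / r) z))).
    apply: le_Rintegral => //.
      apply: (bounded_integrable (1 + 3 / r)).
        by apply: measurable_funD => //; exact: measurable_indic.
      move=> z; have r3 : 0 <= 3 / r by rewrite divr_ge0// ltW.
      by rewrite /= indicE ger0_norm ?addr_ge0// lerD2r; case: (_ \in _).
    move=> z _; rewrite indicE /cst; case: (boolP (z \in A)) => [_|].
      rewrite (le_trans (curve_gap_le1 _ _ (clip_ge0 z)))// lerDl.
      by rewrite divr_ge0// ltW.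
    rewrite notin_setE /A/= => /negP; rewrite -ltNge => zr.
    rewrite add0r (le_trans (curve_gap_upper _ _ (clip_ge0 z)))//.
    rewrite ler_wpM2l// lef_pV2 ?posrE ?ltr_pwDl//.
    have := lerB_normD (k * l) z.2.
    rewrite [k * l + _]addrC normrM (gtr0_norm k_gt0); move: zr; rewrite /r.
    lra.
  rewrite RintegralD//; apply: lerD.
    rewrite /Rintegral integral_indic// setIT; exact: QA.
  by rewrite [leLHS]Rintegral_prob_cst.
have rE : D / r ^+ 2 + 3 / r = 4 * D / k ^+ 2 / `|l| ^+ 2 + 6 / k / `|l|.
  by rewrite /r; field; rewrite !gt_eqF.
rewrite {}rE in gl.
have h1 : `|l|^-1 * (1 + `|l|) <= 2 by rewrite ler_pdivrMl//; lra.
have h2 : (`|l| ^+ 2)^-1 * (1 + `|l|) <= 2.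
  by rewrite ler_pdivrMl ?exprn_gt0//; nra.
have D1 : 0 <= 4 * D / k ^+ 2 by rewrite divr_ge0 ?mulr_ge0 ?exprn_ge0 ?ltW.
have D2 : 0 <= 6 / k by rewrite divr_ge0 ?ltW.
have l1p : 0 < 1 + `|l| by lra.
apply: le_trans (ler_wpM2r (ltW l1p) gl) _.
rewrite mulrDl -!mulrA.
set U := _^-1 * (1 + _) in h2; set V := _^-1 * (1 + _) in h1.
have -> : 12 / k = 2 * (6 / k) by field; rewrite gt_eqF.
have -> : 8 * (D / k ^+ 2) = 2 * (4 * D / k ^+ 2) by field; rewrite gt_eqF.
rewrite !mulrA in D1 D2 *.
have := ler_wpM2l D1 h2; have := ler_wpM2l D2 h1; rewrite /U /V; lra.
Qed.

Let curve_ratio (f : Z -> R) : measurable_fun setT f ->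
  curve (fun z => f z + 1) <= 2 * expR (2 * a) * curve (fun z => f z - 1).
Proof.
move=> mf; rewrite -RintegralZl//; last first.
  by apply: integrable_curve; exact: measurable_funB.
apply: le_Rintegral => //.
- by apply: integrable_curve; exact: measurable_funD.
- apply: (bounded_integrable (2 * expR (2 * a))).
    apply: measurable_funM => //; apply: measurable_curve.
    exact: measurable_funB.
  move=> z; rewrite normrM !ger0_norm ?mulr_ge0 ?expR_ge0 ?plus_curve_ge0//.
  by rewrite ler_piMr ?mulr_ge0 ?expR_ge0 ?plus_curve_le1.
- by move=> z _; exact: plus_curve_ratio.
Qed.

Lemma report_estimates : exists K C c b c0, report_bounds
  (prob_report_plus sigma G 1) (prob_report_plus sigma G (-1)) K C c b c0.
Proof.
have [C C0 CP] := gap_upper.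
exists (2 * expR (2 * a)), C, (\int[Q]_z weight z), (a * k).
exists (Num.min (level (-1)) (level 1)).
split => //.
- have : 1 < expR (2 * a) by rewrite expR_gt1 mulr_gt0.
  lra.
- by rewrite mulr_gt0.
- by rewrite lt_min !level_gt0.
- move=> l; rewrite -/(m l) mE (lt_le_trans (level_gt0 (k * l - 1)))//.
  by apply: level_le => // z; rewrite addrA.
- move=> l; rewrite -/(p l) -subr_gt0 pE (lt_le_trans (level_gt0 (k * l + 1)))//.
  by apply: levelC_le => // z; rewrite addrA.
- by move=> l; rewrite -/(p l) -/(m l) pE mE; exact: curve_ratio.
(* The symmetry of the curve exchanges the two states and reduces this to the ratio bound just
   used. *)
- move=> l; rewrite -/(p l) -/(m l) pE mE !curveN//.
  have h (t : R) : (fun z : Z => - (z.2 + k * l + t)) = (fun z => - (z.2 + k * l) - t).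
    by apply/funext => z; rewrite opprD.
  rewrite !h opprK; apply: (curve_ratio (fun z => - (z.2 + k * l))).
  exact: measurableT_comp.
- move=> l l0; rewrite -/(m l) mE ge_min; apply/orP; left.
  apply: level_le => // z; rewrite -addrA lerD2l lerDr mulr_ge0//.
  exact: ltW.
- move=> l l0; rewrite -/(p l) pE ge_min; apply/orP; right.
  apply: levelC_le => // z; rewrite -addrA lerD2l gerDr.
  by rewrite pmulr_rle0.
Qed.

End report_estimates.

(** * The chain of public log-likelihood ratios *)

Section belief_chain.
Context {R : realType} {p m : R -> R} {K C c b c0 : R}.
Hypothesis H : report_bounds p m K C c b c0.

Definition llr_jump (p m : R -> R) (up : bool) (l : R) : R :=
  if up then ln (p l / m l) else ln ((1 - p l) / (1 - m l)).

Let m_lt_p l : m l < p l.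
Proof.
rewrite -subr_gt0; apply: lt_le_trans (rb_gap_lower H l).
by rewrite mulr_gt0 ?expR_gt0 ?(rb_c H).
Qed.

Let m_gt0 l : 0 < m l. Proof. exact: rb_m_gt0 H l. Qed.
Let p_lt1 l : p l < 1. Proof. exact: rb_p_lt1 H l. Qed.
Let p_gt0 l : 0 < p l. Proof. exact: lt_trans (m_gt0 l) (m_lt_p l). Qed.
Let q_gt0 l : 0 < 1 - p l. Proof. by rewrite subr_gt0. Qed.
Let r_gt0 l : 0 < 1 - m l.
Proof. by rewrite subr_gt0 (lt_trans (m_lt_p l)). Qed.

Let ln_le (x : R) : 0 < x -> ln x <= x - 1.
Proof.
move=> x0; have := @le_ln1Dx R (x - 1); rewrite addrCA subrr addr0; apply.
lra.
Qed.

Let K_gt0 : 0 < K. Proof. exact: lt_trans ltr01 (rb_K H). Qed.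

Let jump_up_ge0 l : 0 <= llr_jump p m true l.
Proof. by rewrite ln_ge0// ler_pdivlMr// mul1r ltW. Qed.

Let jump_down_le0 l : llr_jump p m false l <= 0.
Proof. by rewrite ln_le0// ler_pdivrMr// mul1r lerB// ltW. Qed.

Let jump_up_le l : llr_jump p m true l <= ln K.
Proof. by rewrite ler_ln ?posrE ?divr_gt0// ler_pdivrMr// (rb_ratio H). Qed.

Let jump_down_ge l : - ln K <= llr_jump p m false l.
Proof.
rewrite -lnV ?posrE// ler_ln ?posrE ?invr_gt0 ?divr_gt0//.
by rewrite ler_pdivlMr// ler_pdivrMl// (rb_ratioC H).
Qed.

Let E_ge0 : 0 <= C / c0.
Proof. by rewrite divr_ge0// ltW ?(rb_C H) ?(rb_c0 H). Qed.

(** From [ln x <= x - 1] the jump is at most the gap divided by [m l]; for [l >= 0] the gap is at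
    most [C / (1 + l)] and [m l] at least [c0]. *)
Let jump_up_far l : 0 <= l -> llr_jump p m true l * (1 + l) <= C / c0.
Proof.
move=> l0; have c00 := rb_c0 H; have lp : 0 < 1 + l by lra.
rewrite -ler_pdivlMr//; apply: le_trans (ln_le _ _) _; first exact: divr_gt0.
have -> : p l / m l - 1 = (p l - m l) / m l.
  by field; rewrite gt_eqF.
apply: (@le_trans _ _ ((C / (1 + l)) / m l)).
  rewrite ler_pM2r ?invr_gt0//; have := rb_gap_upper H l.
  by rewrite ger0_norm.
rewrite mulrAC ler_pM2r ?invr_gt0// ler_pM2l ?(rb_C H)//.
by rewrite lef_pV2 ?posrE// (rb_floor H).
Qed.

Let jump_down_far l : l <= 0 -> - (C / c0) <= llr_jump p m false l * (1 - l).
Proof.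
move=> l0; have c00 := rb_c0 H; have lp : 0 < 1 - l by lra.
rewrite lerNl -mulNr -ler_pdivlMr// -lnV ?posrE ?divr_gt0// invf_div.
apply: le_trans (ln_le _ _) _; first exact: divr_gt0.
have -> : (1 - m l) / (1 - p l) - 1 = (p l - m l) / (1 - p l).
  by field; rewrite gt_eqF.
apply: (@le_trans _ _ ((C / (1 - l)) / (1 - p l))).
  rewrite ler_pM2r ?invr_gt0//; have := rb_gap_upper H l.
  by rewrite ler0_norm.
rewrite mulrAC ler_pM2r ?invr_gt0// ler_pM2l ?(rb_C H)//.
by rewrite lef_pV2 ?posrE// (rb_floorC H).
Qed.

Lemma llr_square_growth : exists2 B : R, 0 < B &
  forall l up, (l + llr_jump p m up l) ^+ 2 <= l ^+ 2 + B.
Proof.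
have K0 : 0 < ln K by rewrite ln_gt0 ?(rb_K H).
(* In the expansion of the square, a jump away from 0 has cross term at most [2 * (C / c0)] and size
   at most [C / c0]. A jump towards 0 has nonpositive cross term and size at most [ln K]. *)
exists (2 * (C / c0) + (C / c0) ^+ 2 + ln K ^+ 2).
  by have := E_ge0; have := exprn_gt0 2 K0; have := sqr_ge0 (C / c0); lra.
move=> l up.
have E0 := E_ge0; move: (ln K) (C / c0) K0 E0
  (jump_up_le l) (jump_down_ge l) (@jump_up_far l) (@jump_down_far l)
  => D E D0 E0 uD dD uE dE.
case: up.
  have u0 := jump_up_ge0 l; move: (llr_jump _ _ _ _) u0 uD uE => u u0 uD uE.
  have [l0|l0] := leP 0 l; last nra.
  have {}uE := uE l0; have ul := mulr_ge0 u0 l0; nra.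
have u0 := jump_down_le0 l; move: (llr_jump _ _ _ _) u0 dD dE => u u0 dD dE.
have [l0|l0] := leP l 0; last nra.
have {}dE := dE l0; have ul : 0 <= u * l by rewrite mulr_le0. nra.
Qed.

(** The transition operator of the chain in state +1. Its iterates express expectations after
    several steps without conditional expectations. *)
Definition chain_step (p m : R -> R) (f : R -> R) (l : R) : R :=
  p l * f (l + llr_jump p m true l) + (1 - p l) * f (l + llr_jump p m false l).

Let chain_step_le f g : (forall l, f l <= g l) ->
  forall l, chain_step p m f l <= chain_step p m g l.
Proof. by move=> fg l; rewrite lerD// ler_pM2l. Qed.

(** Square root of the likelihood ratio of state -1 to state +1; its strict concavity in that ratio
    produces a drift. *)
Definition half_llr (l : R) : R := expR (- l / 2).

(* The likelihood ratio [expR (- l)] is a martingale. *)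
Let chain_step_expRN l : chain_step p m (fun l => expR (- l)) l = expR (- l).
Proof.
rewrite /chain_step !opprD !expRD /llr_jump !expRN !lnK ?posrE ?divr_gt0//.
by field; rewrite !gt_eqF ?expR_gt0.
Qed.

(* With [p alpha^2 = m] and [(1 - p) beta^2 = 1 - m], the Hellinger affinity
   [p alpha + (1 - p) beta] is at most [1 - p (1 - alpha)^2 / 2]. *)
Let chain_step_half l : chain_step p m half_llr l <=
  (1 - c ^+ 2 / 8 * expR (- (2 * b * `|l|))) * half_llr l.
Proof.
rewrite /chain_step /half_llr.
have hD up : expR (- (l + llr_jump p m up l) / 2) =
    expR (- l / 2) * expR (- llr_jump p m up l / 2).
  by rewrite -expRD; congr expR; ring.
rewrite !hD.
set al := expR (- llr_jump p m true l / 2).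
set be := expR (- llr_jump p m false l / 2).
have sq (x : R) : expR (- x / 2) ^+ 2 = expR (- x).
  by rewrite expr2 -expRD; congr expR; field.
have al2 : p l * al ^+ 2 = m l.
  rewrite sq expRN lnK ?posrE ?divr_gt0// invf_div mulrC divfK// gt_eqF//.
have be2 : (1 - p l) * be ^+ 2 = 1 - m l.
  rewrite sq expRN lnK ?posrE ?divr_gt0// invf_div mulrC divfK// gt_eqF//.
have al0 : 0 <= al by exact: expR_ge0.
have al1 : al <= 1 by rewrite expR_le1; have := jump_up_ge0 l; lra.
have gap := rb_gap_lower H l.
have gap2 : c ^+ 2 * expR (- (2 * b * `|l|)) <= (p l - m l) ^+ 2.
  have -> : c ^+ 2 * expR (- (2 * b * `|l|)) = (c * expR (- (b * `|l|))) ^+ 2.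
    rewrite exprMn; congr (_ * _); rewrite expr2 -expRD; congr expR; ring.
  rewrite ler_pXn2r// nnegrE ?subr_ge0 ?(ltW (m_lt_p l))//.
  by rewrite mulr_ge0 ?expR_ge0// ltW ?(rb_c H).
have aff : p l * al + (1 - p l) * be <= 1 - (p l - m l) ^+ 2 / 8.
  have E1 : 2 * (1 - (p l * al + (1 - p l) * be)) =
      p l * (1 - al) ^+ 2 + (1 - p l) * (1 - be) ^+ 2.
    rewrite !sqrrB !expr1n; lra.
  (* [p - m] factors as [p * (1 - al) * (1 + al)] because [m = p * al ^+ 2], and
     [p * (1 + al) ^+ 2 <= 4]. With the 2 of the previous identity this gives the 8. *)
  have E2 : (p l - m l) ^+ 2 <= 4 * (p l * (1 - al) ^+ 2).
    have -> : p l - m l = p l * (1 - al) * (1 + al) by rewrite -al2; ring.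
    have -> : (p l * (1 - al) * (1 + al)) ^+ 2 =
        p l * (1 - al) ^+ 2 * (p l * (1 + al) ^+ 2) by ring.
    have h0 : 0 <= p l * (1 - al) ^+ 2 := mulr_ge0 (ltW (p_gt0 l)) (sqr_ge0 _).
    have h4 : p l * (1 + al) ^+ 2 <= 4.
      have p0 := p_gt0 l; have p1 := p_lt1 l.
      have : (1 + al) ^+ 2 <= 4 by nra.
      have := sqr_ge0 (1 + al); nra.
    by rewrite mulrC ler_wpM2r.
  have := mulr_ge0 (ltW (q_gt0 l)) (sqr_ge0 (1 - be)); lra.
have -> : p l * (expR (- l / 2) * al) + (1 - p l) * (expR (- l / 2) * be) =
    (p l * al + (1 - p l) * be) * expR (- l / 2) by ring.
rewrite ler_pM2r ?expR_gt0//; lra.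
Qed.

Lemma chain_step_half_le l : chain_step p m half_llr l <= half_llr l.
Proof.
apply: le_trans (chain_step_half l) _; rewrite ler_piMl ?expR_ge0// gerBl.
by rewrite mulr_ge0 ?expR_ge0// divr_ge0// sqr_ge0.
Qed.

Let c_le1 : c <= 1.
Proof.
have := rb_gap_lower H 0; rewrite normr0 mulr0 oppr0 expR0 mulr1.
have := p_lt1 0; have := m_gt0 0; lra.
Qed.

(** The contraction guaranteed on [|l| <= 2 * u], where [2 * b * |l| <= 4 * b * u]. *)
Let rate (u : R) := c ^+ 2 / 8 * expR (- (4 * b * u)).

Let rate_gt0 u : 0 < rate u.
Proof. by rewrite mulr_gt0 ?expR_gt0// divr_gt0// exprn_gt0// (rb_c H). Qed.

Let rate_le1 u : 0 <= u -> rate u <= 1.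
Proof.
move=> u0; have b0 := rb_b H; have c0' := rb_c H.
have : expR (- (4 * b * u)) <= 1 by rewrite expR_le1 oppr_le0 !mulr_ge0// ltW.
have := expR_ge0 (- (4 * b * u)); rewrite /rate.
have : c ^+ 2 <= 1 by rewrite expr_le1// ltW.
have := sqr_ge0 c; nra.
Qed.

(** Inside [|l| <= 2 * u] the contraction alone suffices. Outside, [half_llr l] is at most
    [expR (- u)] on the right and [expR (- u) * expR (- l)] on the left, so the additive term pays
    for the missing contraction. *)
Let chain_step_drift u l : 0 <= u -> chain_step p m half_llr l <=
  (1 - rate u) * half_llr l + rate u * (expR (- u) * (1 + expR (- l))).
Proof.
move=> u0; have b0 := rb_b H.
have h0 : 0 < half_llr l by exact: expR_gt0.
have st := chain_step_half l.
have dr : 0 <= c ^+ 2 / 8 * expR (- (2 * b * `|l|)).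
  by rewrite mulr_ge0 ?expR_ge0// divr_ge0// sqr_ge0.
have tail : 0 <= rate u * (expR (- u) * (1 + expR (- l))).
  by rewrite mulr_ge0 ?(ltW (rate_gt0 u))// mulr_ge0 ?expR_ge0// addr_ge0 ?expR_ge0.
have [lu|lu] := leP `|l| (2 * u).
  apply: le_trans st _; rewrite -[leLHS]addr0 lerD// ler_pM2r// lerB//.
  rewrite ler_pM2l ?divr_gt0 ?exprn_gt0 ?(rb_c H)// ler_expR; nra.
suff hl : half_llr l <= expR (- u) * (1 + expR (- l)).
  have := rate_gt0 u; nra.
have := expR_ge0 (- u); have := expR_ge0 (- l).
have [l0|l0] := leP 0 l.
  have : half_llr l <= expR (- u).
    by rewrite ler_expR; move: lu; rewrite ger0_norm//; lra.
  nra.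
have : half_llr l <= expR (- u) * expR (- l).
  by rewrite -expRD ler_expR; move: lu; rewrite ltr0_norm//; lra.
nra.
Qed.

(** The drift inequality is iterated; its additive term does not accumulate, because [expR (- l)] is
    a martingale and so keeps its mean. *)
Let iter_chain_half u n l : 0 <= u -> iter n (chain_step p m) half_llr l <=
  (1 - rate u) ^+ n * half_llr l +
  (1 - (1 - rate u) ^+ n) * (expR (- u) * (1 + expR (- l))).
Proof.
move=> u0; elim: n l => [|n IH] l /=; first by rewrite expr0 subrr mul0r mul1r addr0.
apply: le_trans (chain_step_le _ _ IH l) _.
have := chain_step_drift _ l u0; have := chain_step_expRN l; rewrite /chain_step.
have r0 := rate_gt0 u; have r1 := rate_le1 _ u0.
have x0 : 0 <= (1 - rate u) ^+ n by rewrite exprn_ge0// subr_ge0.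
rewrite exprS.
set x := (1 - rate u) ^+ n in x0 *.
set h1 := half_llr (l + llr_jump p m true l).
set h2 := half_llr (l + llr_jump p m false l).
set e1 := expR (- (l + llr_jump p m true l)).
set e2 := expR (- (l + llr_jump p m false l)).
move=> Ee Eh.
have -> : p l * (x * h1 + (1 - x) * (expR (- u) * (1 + e1))) +
    (1 - p l) * (x * h2 + (1 - x) * (expR (- u) * (1 + e2))) =
    x * (p l * h1 + (1 - p l) * h2) +
    (1 - x) * (expR (- u) * (1 + (p l * e1 + (1 - p l) * e2))) by ring.
rewrite Ee; have := ler_wpM2l x0 Eh; lra.
Qed.

Lemma chain_half_decay : exists2 N : nat, (1 < N)%N & exists2 A : R, 0 < A &
  forall j : nat, iter (N ^ j) (chain_step p m) half_llr 0 <=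
    A * expR (- j%:R).
Proof.
(* With [u = j] the contraction is of order [expR (- (4 * b * j))]; this base makes [N ^ j] steps
   accumulate at least [c ^+ 2 / 8 * expR j]. Two successors ensure [1 < N]. *)
pose N := (Num.bound (expR (4 * b + 1))).+2.
have Nb : expR (4 * b + 1) <= N%:R.
  apply/ltW/(lt_le_trans (archi_boundP (expR_ge0 _))).
  by rewrite ler_nat /N ltnW.
(* The first summand comes from [(1 - r) ^+ n <= expR (- (n * r)) <= 1 / (n * r)], the 2 from
   [1 + expR (- l)] at the start [l = 0]. *)
exists N => //; exists (8 / c ^+ 2 + 2).
  by rewrite addr_gt0// divr_gt0// exprn_gt0// (rb_c H).
move=> j; have j0 : 0 <= j%:R :> R by exact: ler0n.
apply: le_trans (iter_chain_half _ (N ^ j) 0 j0) _.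
rewrite {1}/half_llr oppr0 mul0r expR0 mulr1 [leRHS]mulrDl.
have r0 := rate_gt0 j%:R; have r1 := rate_le1 _ j0.
have x0 : 0 <= (1 - rate j%:R) ^+ (N ^ j) by rewrite exprn_ge0// subr_ge0.
apply: lerD; last first.
  by have := expR_ge0 (- j%:R : R); nra.
have Nr : c ^+ 2 / 8 * expR j%:R <= (N ^ j)%:R * rate j%:R.
  rewrite /rate mulrCA ler_pM2l ?divr_gt0 ?exprn_gt0 ?(rb_c H)//.
  rewrite expRN ler_pdivlMr ?expR_gt0// -expRD natrX.
  have -> : j%:R + 4 * b * j%:R = (4 * b + 1) * j%:R by ring.
  by rewrite expRM_natr lerXn2r ?nnegrE ?expR_ge0.
have w0 : 0 < c ^+ 2 / 8 * expR j%:R.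
  by rewrite mulr_gt0 ?expR_gt0// divr_gt0// exprn_gt0// (rb_c H).
apply: (@le_trans _ _ (expR (- ((N ^ j)%:R * rate j%:R)))).
  have -> : - ((N ^ j)%:R * rate j%:R) = - rate j%:R * (N ^ j)%:R by ring.
  rewrite expRM_natr lerXn2r ?nnegrE ?subr_ge0 ?expR_ge0//.
  by have := expR_ge1Dx (- rate j%:R); lra.
have -> : 8 / c ^+ 2 * expR (- j%:R) = (c ^+ 2 / 8 * expR j%:R)^-1.
  by rewrite expRN; field; rewrite !gt_eqF ?expR_gt0 ?(rb_c H).
rewrite expRN lef_pV2 ?posrE ?expR_gt0//; apply: (le_trans Nr).
by have := expR_ge1Dx ((N ^ j)%:R * rate j%:R); lra.
Qed.

End belief_chain.

(** * Joint laws from rectangles *)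

Section joint_law.
Context {d d1 d2} {T : measurableType d} {T1 : measurableType d1}
  {T2 : measurableType d2} {R : realType} {P : probability T R}.

(** Uniqueness of the product measure, applied to the joint law restricted to [A]. Scaling [Q1] by
    [P A] instead of conditioning on [A] also covers null events. *)
Lemma joint_law_product (Q1 : probability T1 R) (Q2 : probability T2 R)
    (X1 : T -> T1) (X2 : T -> T2) (A : set T) :
  measurable_fun setT X1 -> measurable_fun setT X2 -> measurable A ->
  (forall B1 B2, measurable B1 -> measurable B2 ->
    P (A `&` (X1 @^-1` B1 `&` X2 @^-1` B2)) = (P A * (Q1 B1 * Q2 B2))%E) ->
  forall D, measurable D ->
    P (A `&` (fun w => (X1 w, X2 w)) @^-1` D) = (P A * (Q1 \x Q2)%E D)%E.
Proof.
move=> mX1 mX2 mA AB D mD.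
have mX : measurable_fun setT (fun w => (X1 w, X2 w)).
  exact: measurable_fun_pair.
have PA0 : 0 <= fine (P A) by rewrite fine_ge0.
have PAE : P A = (fine (P A))%:E by rewrite fineK ?fin_num_measure.
pose r : {nonneg R} := NngNum PA0.
pose m1 := mscale r Q1.
pose m' := pushforward (mrestr P mA) (fun w => (X1 w, X2 w)).
have rect B1 B2 : measurable B1 -> measurable B2 ->
    m' (B1 `*` B2) = (m1 B1 * Q2 B2)%E.
  move=> mB1 mB2; rewrite /m' /pushforward /mrestr /m1 /mscale/=.
  by rewrite -PAE -muleA -AB// setIC.
have := @product_measure_unique _ _ _ _ _ m1 Q2 m' rect D mD.
rewrite /m' /= /pushforward /mrestr setIC => <-.
rewrite /product_measure1 ge0_integral_mscale//=; last first.
  exact: measurable_fun_xsection.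
  by rewrite -PAE.
exact: mX.
Qed.

End joint_law.

(** * Independence of the past from the agents to come *)

Section agents.
Context {d} {T : measurableType d} {R : realType} {P : probability T R}.
Context {sigma a : R} {G : probability R R} {s eps v : nat -> {RV P >-> R}}.
Hypotheses (sigma_gt0 : 0 < sigma) (Ga : G (~` `[0, a]) = 0%E).
Hypothesis s_law : forall n B, measurable B ->
  distribution P (s n) B = normal_prob 1 sigma B.
Hypothesis eps_law : forall n B, measurable B ->
  distribution P (eps n) B = G B.
Hypothesis v_law : forall n B, measurable B ->
  distribution P (v n) B = uniform_prob (@ltr01 R) B.

Let X : nat * 'I_3 -> T -> R := agent_family (fun n => s n : T -> R)
  (fun n => eps n : T -> R) (fun n => v n : T -> R).
Hypothesis indep : mutually_independent P X.

(** Replaces a filtration: the event is independent of every finite family of variables of the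
    agents from [n] on. *)
Definition past_event (n : nat) (A : set T) : Prop :=
  measurable A /\
  forall (J : seq (nat * 'I_3)) (B : nat * 'I_3 -> set R), uniq J ->
    (forall i, i \in J -> (n <= i.1)%N) -> (forall i, measurable (B i)) ->
    P (A `&` \big[setI/setT]_(i <- J) (X i @^-1` B i)) =
      (P A * \prod_(i <- J) P (X i @^-1` B i))%E.

Lemma past_eventT : past_event 0 setT.
Proof.
split=> [|J B uJ _ mB]; first exact: measurableT.
by rewrite setTI probability_setT mul1e; exact: indep.
Qed.

Let Y n (w : T) : R * (measurableTypeR R * measurableTypeR R) :=
  (eps n w, (s n w, v n w)).

Let bigI_measurable (J : seq (nat * 'I_3)) (B : nat * 'I_3 -> set R) :
  (forall i, measurable (B i)) ->
  measurable (\big[setI/setT]_(i <- J) (X i @^-1` B i)).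
Proof.
move=> mB; apply: big_ind => //; first exact: measurableI.
move=> [i k] _; rewrite -[X in measurable X]setTI /X /agent_family.
by case: k => [[|[|k]] Hk] /=; apply: measurable_funP.
Qed.

Let o0 : 'I_3 := @Ordinal 3 0 isT.
Let o1 : 'I_3 := @Ordinal 3 1 isT.
Let o2 : 'I_3 := @Ordinal 3 2 isT.

Let past_event_rect n A (J : seq (nat * 'I_3)) (B : nat * 'I_3 -> set R)
    (B0 B1 B2 : set R) :
  past_event n A -> uniq J -> (forall i, i \in J -> (n.+1 <= i.1)%N) ->
  (forall i, measurable (B i)) ->
  measurable B0 -> measurable B1 -> measurable B2 ->
  P (A `&` (eps n @^-1` B0 `&` (s n @^-1` B1 `&` (v n @^-1` B2 `&`
      \big[setI/setT]_(i <- J) (X i @^-1` B i))))) =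
  (P A * (G B0 * (normal_prob 1 sigma B1 * (uniform_prob (@ltr01 R) B2 *
    \prod_(i <- J) P (X i @^-1` B i)))))%E.
Proof.
move=> [mA indA] uJ Jn mB mB0 mB1 mB2.
(* The three variables of agent [n] are put in front of [J], in the order budget, signal, noise of
   [agent_law]. *)
pose B' i := if i == (n, o1) then B0 else if i == (n, o0) then B1
  else if i == (n, o2) then B2 else B i.
have mB' i : measurable (B' i) by rewrite /B'; do 3 case: ifP => // _.
have nJ k : (n, k) \notin J.
  by apply/negP => /Jn /=; rewrite ltnn.
have BJ i : i \in J -> B' i = B i.
  move=> iJ; rewrite /B'; do 3 (case: eqP => [E|_]; first by
    move: iJ; rewrite E (negbTE (nJ _))).
  by [].
have uJ' : uniq [:: (n, o1), (n, o0), (n, o2) & J].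
  by rewrite /= !inE !(negbTE (nJ _)) uJ !xpair_eqE !eqxx.
have gJ i : i \in [:: (n, o1), (n, o0), (n, o2) & J] -> (n <= i.1)%N.
  by rewrite !inE => /or4P[/eqP->|/eqP->|/eqP->|/Jn/ltnW].
have := indA _ B' uJ' gJ mB'.
rewrite !big_cons.
rewrite [\big[setI/setT]_(j <- J) _](eq_big_seq (fun i => X i @^-1` B i)); last first.
  by move=> i iJ; rewrite BJ.
rewrite /B' !xpair_eqE !eqxx /= => E; apply: (etrans E).
congr (_ * (_ * (_ * (_ * _))))%E.
- exact: eps_law.
- exact: s_law.
- exact: v_law.
- by apply: eq_big_seq => i /BJ; rewrite /B' => ->.
Qed.

(** Rectangles suffice, by two uses of [joint_law_product]: the outer one separates the budget from
    the pair of signal and noise, the inner one separates these two. Future variables are carried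
    along so that the next event is again a past event. *)
Let past_event_agent n A (J : seq (nat * 'I_3)) (B : nat * 'I_3 -> set R) D :
  past_event n A -> uniq J -> (forall i, i \in J -> (n.+1 <= i.1)%N) ->
  (forall i, measurable (B i)) -> measurable D ->
  P ((A `&` \big[setI/setT]_(i <- J) (X i @^-1` B i)) `&` Y n @^-1` D) =
  (P (A `&` \big[setI/setT]_(i <- J) (X i @^-1` B i)) * agent_law sigma G D)%E.
Proof.
move=> pA uJ Jn mB mD.
have [mA indA] := pA.
set I := \big[setI/setT]_(i <- J) _.
have mI : measurable I by exact: bigI_measurable.
have rect B0 B1 B2 := @past_event_rect n A J B B0 B1 B2 pA uJ Jn mB.
set pJ := (\prod_(i <- J) _)%E in rect.
have PAI : P (A `&` I) = (P A * pJ)%E.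
  have := rect setT setT setT measurableT measurableT measurableT.
  by rewrite !preimage_setT !setTI !probability_setT !mul1e.
have mRV (Z : {RV P >-> R}) : measurable_fun setT (Z : T -> R).
  exact: measurable_funP.
have meps := mRV (eps n).
have ms : measurable_fun setT (s n : T -> measurableTypeR R) := mRV (s n).
have mv : measurable_fun setT (v n : T -> measurableTypeR R) := mRV (v n).
have PAIe B0 : measurable B0 ->
    P (A `&` I `&` eps n @^-1` B0) = (P (A `&` I) * G B0)%E.
  move=> mB0; have := rect B0 setT setT mB0 measurableT measurableT.
  rewrite !preimage_setT !setTI !probability_setT !mul1e PAI.
  by rewrite -setIA [I `&` _]setIC -muleA [(pJ * _)%E]muleC.
apply: (joint_law_product G (signal_noise_law sigma)) => //.
- exact: measurable_fun_pair.
- exact: measurableI.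
move=> B0 B12 mB0 mB12; rewrite setIA.
have mE : measurable (A `&` I `&` eps n @^-1` B0).
  apply: measurableI; first exact: measurableI.
  by rewrite -[X in measurable X]setTI; exact: meps.
rewrite (joint_law_product (normal_prob 1 sigma) (uniform_prob (@ltr01 R)))//.
  by rewrite PAIe// muleA.
move=> B1 B2 mB1 mB2; rewrite PAIe// PAI.
have := rect B0 B1 B2 mB0 mB1 mB2.
have -> : A `&` I `&` eps n @^-1` B0 `&` (s n @^-1` B1 `&` v n @^-1` B2) =
  A `&` (eps n @^-1` B0 `&` (s n @^-1` B1 `&` (v n @^-1` B2 `&` I))).
  by apply/seteqP; split => w /=; tauto.
move=> ->; rewrite -!muleA; congr (_ * _)%E.
by rewrite [RHS]muleC -!muleA; congr (_ * (_ * _))%E.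
Qed.

Lemma past_event_report n A D : past_event n A -> measurable D ->
  past_event n.+1 (A `&` Y n @^-1` D) /\
  P (A `&` Y n @^-1` D) = (P A * agent_law sigma G D)%E.
Proof.
move=> pA mD; have [mA indA] := pA.
have PE : P (A `&` Y n @^-1` D) = (P A * agent_law sigma G D)%E.
  have := @past_event_agent n A [::] (fun=> setT) D pA.
  by rewrite !big_nil !setIT; apply.
split=> //; split.
  apply: measurableI => //; rewrite -[X in measurable X]setTI.
  suff : measurable_fun setT (Y n) by exact.
  have mRV (Z : {RV P >-> R}) : measurable_fun setT (Z : T -> R).
    exact: measurable_funP.
  have ms : measurable_fun setT (s n : T -> measurableTypeR R) := mRV (s n).
  have mv : measurable_fun setT (v n : T -> measurableTypeR R) := mRV (v n).
  apply: measurable_fun_pair; first exact: mRV.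
  exact: measurable_fun_pair.
move=> J B uJ Jn mB; rewrite PE setIAC past_event_agent// indA//; last first.
  by move=> i /Jn/ltnW.
by rewrite muleAC.
Qed.

(** * The public log-likelihood ratio on the tree of past events *)

Let L n (w : T) : R := pub_llr sigma G (fun n => s n : T -> R)
  (fun n => eps n : T -> R) (fun n => v n : T -> R) w n.
Let p : R -> R := prob_report_plus sigma G 1.
Let m : R -> R := prob_report_plus sigma G (-1).

Let x n w := reported_action sigma (L n w) (s n w) (eps n w) (v n w).

Let x_plus n w : x n w = 1 -> L n.+1 w = L n w + llr_jump p m true (L n w).
Proof.
rewrite /L /= -/(L n w) -/(x n w) => ->.
by rewrite /llr_increment /prob_report eqxx.
Qed.

Let x_minus n w : x n w <> 1 -> L n.+1 w = L n w + llr_jump p m false (L n w).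
Proof.
move=> x1; have xm : x n w = -1.
  by have [|] := reported_action_or sigma (L n w) (s n w) (eps n w) (v n w).
rewrite /L /= -/(L n w) -/(x n w) xm.
have n1 : (-1 == 1 :> R) = false by apply/negP => /eqP; lra.
by rewrite /llr_increment /prob_report n1.
Qed.

Lemma pub_llr_square_bound (B : R) :
  (forall l up, (l + llr_jump p m up l) ^+ 2 <= l ^+ 2 + B) ->
  forall n w, L n w ^+ 2 <= B * n%:R.
Proof.
move=> HB n w; elim: n => [|n IH]; first by rewrite /L /= expr0n mulr0.
have [x1|x1] := pselect (x n w = 1).
  rewrite (x_plus _ _ x1) (le_trans (HB _ _))// -natr1 mulrDr mulr1 lerD2r.
  exact: IH.
rewrite (x_minus _ _ x1) (le_trans (HB _ _))// -natr1 mulrDr mulr1 lerD2r.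
exact: IH.
Qed.

(** Where the belief is a constant [l], the report depends only on the data of agent [n]. Splitting
    by the report yields two past events with constant belief again, so paths form a binary tree and
    the Markov property is elementary. *)
Lemma past_event_split n A l : past_event n A -> (forall w, A w -> L n w = l) ->
  exists Au Ad, [/\ past_event n.+1 Au, past_event n.+1 Ad, A = Au `|` Ad,
    P Au = (P A * (p l)%:E)%E & P Ad = (P A * (1 - p l)%:E)%E] /\
    (forall w, Au w -> L n.+1 w = l + llr_jump p m true l) /\
    (forall w, Ad w -> L n.+1 w = l + llr_jump p m false l).
Proof.
move=> pA Al.
have mD := measurable_plus_report_set sigma l.
have mDc : measurable (~` plus_report_set sigma l) by exact: measurableC.
have PD := plus_report_set_prob a sigma l G sigma_gt0 Ga.
exists (A `&` Y n @^-1` plus_report_set sigma l).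
exists (A `&` Y n @^-1` (~` plus_report_set sigma l)).
have [pu Pu] := past_event_report _ _ _ pA mD.
have [pd Pd] := past_event_report _ _ _ pA mDc.
split; first split => //.
- by rewrite -setIUr -preimage_setU setUv preimage_setT setIT.
- by rewrite Pu PD.
- rewrite Pd; congr (_ * _)%E.
  by rewrite (probability_setC (agent_law sigma G)) ?PD.
split=> w [Aw Dw].
  by have := x_plus n w; rewrite /x (Al _ Aw); apply.
by have := x_minus n w; rewrite /x (Al _ Aw); apply.
Qed.

(** [S] is arbitrary because [L n] takes finitely many values, each on leaves of the binary tree. *)
Lemma measurable_pub_llr (S : set R) n : measurable [set w | S (L n w)].
Proof.
suff main r k A l : past_event k A -> (forall w, A w -> L k w = l) ->
    measurable (A `&` [set w | S (L (k + r)%N w)]).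
  have := main n 0%N setT 0 past_eventT (fun _ _ => erefl).
  by rewrite setTI add0n.
elim: r k A l => [|r IH] k A l pA Al.
  rewrite addn0; have [Sl|Sl] := pselect (S l).
    rewrite (_ : _ `&` _ = A); first by case: pA.
    by apply/seteqP; split => w /= => [[]//|Aw]; rewrite (Al _ Aw).
  rewrite (_ : _ `&` _ = set0)//.
  by apply/seteqP; split => w //= [Aw]; rewrite (Al _ Aw).
have [Au [Ad [[pu pd -> _ _] [Lu Ld]]]] := past_event_split _ _ _ pA Al.
rewrite setIUl -addSnnS; apply: measurableU; first exact: IH pu Lu.
exact: IH pd Ld.
Qed.

(** * Hitting probabilities and Borel-Cantelli *)

Variables (K C c b c0 : R).
Hypothesis Hpm : report_bounds p m K C c b c0.

Let low_before (z : R) k j : set T :=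
  \bigcup_(i in `I_j.+1) [set w | L (k + i)%N w <= z].

Let measurable_low_before z k j : measurable (low_before z k j).
Proof.
by apply: bigcup_measurable => i _; exact: (measurable_pub_llr (fun y => y <= z)).
Qed.

Let low_beforeS z k j :
  low_before z k j.+1 = [set w | L k w <= z] `|` low_before z k.+1 j.
Proof.
apply/seteqP; split => w /=.
  move=> [[|i] /= ij Lw]; first by left; rewrite addn0 in Lw.
  by right; exists i => //=; rewrite addSnnS.
case=> [Lw|[i /= ij Lw]]; first by exists 0%N => //=; rewrite addn0.
by exists i.+1 => //=; rewrite -addSnnS.
Qed.

Let split_bound n A l E (f : R -> R) :
  past_event n A -> (forall w, A w -> L n w = l) -> measurable E ->
  (forall A' l', past_event n.+1 A' -> (forall w, A' w -> L n.+1 w = l') ->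
    (P (A' `&` E) <= P A' * (f l')%:E)%E) ->
  (P (A `&` E) <= P A * (chain_step p m f l)%:E)%E.
Proof.
move=> pA Al mE IH.
have [Au [Ad [[pu pd AE Pu Pd] [Lu Ld]]]] := past_event_split _ _ _ pA Al.
rewrite {1}AE setIUl; apply: le_trans (measureU2 _ _ _) _.
- by apply: measurableI => //; case: pu.
- by apply: measurableI => //; case: pd.
apply: le_trans (leeD (IH _ _ pu Lu) (IH _ _ pd Ld)) _.
have PAE : P A = (fine (P A))%:E.
  by rewrite fineK// fin_num_measure//; case: pA.
rewrite Pu Pd PAE -!EFinM -EFinD lee_fin /chain_step -!mulrA -mulrDr.
exact: lexx.
Qed.

Let mix_mulr (q y z e : R) :
  q * (y * e) + (1 - q) * (z * e) = (q * y + (1 - q) * z) * e.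
Proof. by ring. Qed.

(* Doob's maximal inequality for the supermartingale [half_llr]. *)
Let maximal z j n A l : past_event n A -> (forall w, A w -> L n w = l) ->
  (P (A `&` low_before z n j) <= P A * (half_llr l * expR (z / 2))%:E)%E.
Proof.
have PAI k B E : past_event k B -> measurable E -> (P (B `&` E) <= P B)%E.
  by move=> [mB _] mE; apply: le_measure; rewrite ?inE//; exact: measurableI.
(* Once the belief is at most [z], the factor [half_llr l' * expR (z / 2)] is at least 1 and the
   bound is trivial. *)
have hit k B l' E : past_event k B -> measurable E -> l' <= z ->
    (P (B `&` E) <= P B * (half_llr l' * expR (z / 2))%:E)%E.
  move=> pB mE lz; apply: le_trans (PAI _ _ _ pB mE) _.
  rewrite -[leLHS]mule1; apply: lee_wpmul2l => //; rewrite lee_fin.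
  rewrite /half_llr -expRD leNgt expR_lt1 -leNgt; lra.
elim: j n A l => [|j IH] n A l pA Al; have [lz|lz] := leP l z;
  try exact: hit pA _ lz.
  rewrite (_ : A `&` _ = set0) ?measure0 ?mule_ge0 ?lee_fin ?mulr_ge0 ?expR_ge0//.
  apply/seteqP; split => w //= [Aw [i /=]]; rewrite ltnS leqn0 => /eqP ->.
  by rewrite addn0 (Al _ Aw) leNgt lz.
rewrite low_beforeS (_ : A `&` _ = A `&` low_before z n.+1 j); last first.
  apply/seteqP; split => w /=; last by move=> [? ?]; split => //; right.
  by move=> [Aw [|//]]; rewrite (Al _ Aw) leNgt lz.
apply: le_trans (split_bound _ _ _ _ (fun l => half_llr l * expR (z / 2)) pA Al _ _) _ => //.
  by move=> A' l'; exact: IH.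
apply: lee_wpmul2l => //; rewrite lee_fin.
have := chain_step_half_le Hpm l; rewrite /chain_step => h.
apply: le_trans (ler_wpM2r (expR_ge0 (z / 2)) h).
by rewrite /chain_step mix_mulr.
Qed.

(** The first [r] steps only average; the maximal inequality takes over at time [n + r]. *)
Let hitting z j r n A l : past_event n A -> (forall w, A w -> L n w = l) ->
  (P (A `&` low_before z (n + r) j) <=
   P A * (iter r (chain_step p m) half_llr l * expR (z / 2))%:E)%E.
Proof.
elim: r n A l => [|r IH] n A l pA Al; first by rewrite addn0; exact: maximal.
rewrite -addSnnS.
apply: le_trans (split_bound _ _ _ _
  (fun l => iter r (chain_step p m) half_llr l * expR (z / 2)) pA Al _ _) _ => //.
  by move=> A' l'; exact: IH.
apply: lee_wpmul2l => //; rewrite lee_fin iterS /chain_step mix_mulr.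
exact: lexx.
Qed.

Let low_after (z : R) k : set T := \bigcup_i [set w | L (k + i)%N w <= z].

Let measurable_low_after z k : measurable (low_after z k).
Proof.
by apply: bigcup_measurable => i _; exact: (measurable_pub_llr (fun y => y <= z)).
Qed.

(** The bound for finite windows does not depend on their length, so continuity from below extends
    it to the infinite horizon. *)
Let low_after_bound z k :
  (P (low_after z k) <= (iter k (chain_step p m) half_llr 0 * expR (z / 2))%:E)%E.
Proof.
have E : low_after z k = \bigcup_j low_before z k j.
  apply/seteqP; split => w [i _ Lw]; first by exists i => //; exists i => /=.
  by case: Lw => j _ Lj; exists j.
have /cvg_lim <- // : P (low_before z k j) @[j --> \oo] --> P (low_after z k).
  rewrite E; apply: nondecreasing_cvg_mu => //.
    exact: bigcup_measurable.
  move=> i j ij; apply/subsetPset => w [h /= hi Lw]; exists h => //=.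
  exact: leq_trans hi _.
apply: lime_le.
  apply/cvg_ex; exists (P (low_after z k)).
  rewrite E; apply: nondecreasing_cvg_mu => //.
    exact: bigcup_measurable.
  move=> i j ij; apply/subsetPset => w [h /= hi Lw]; exists h => //=.
  exact: leq_trans hi _.
apply: nearW => j.
have := hitting z j k 0%N setT 0 past_eventT (fun _ _ => erefl).
by rewrite setTI add0n probability_setT mul1e.
Qed.

Lemma ae_pub_llr_geometric : exists2 N : nat, (1 < N)%N &
  exists2 F : set T, measurable F /\ P F = 0%E &
  forall w, ~ F w -> exists j0 : nat, forall j i : nat, (j0 <= j)%N ->
    (N ^ j <= i)%N -> j%:R < L i w.
Proof.
have [N N1 [A A0 NA]] := chain_half_decay Hpm.
exists N => //.
pose F j := low_after j%:R (N ^ j).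
have mF j : measurable (F j) by exact: measurable_low_after.
(* At level [j] and time [N ^ j], the decay [expR (- j)] outweighs the factor [expR (j / 2)] of the
   maximal inequality, which leaves a summable geometric sequence. *)
pose q : R := expR (- 2^-1).
have q0 : 0 < q by exact: expR_gt0.
have q1 : q < 1 by rewrite expR_lt1 oppr_lt0 invr_gt0.
have PF j : (P (F j) <= (A * q ^+ j)%:E)%E.
  apply: le_trans (low_after_bound _ _) _; rewrite lee_fin.
  apply: le_trans (ler_wpM2r (expR_ge0 _) (NA j)) _.
  rewrite -mulrA -expRD /q -expRM_natr ler_pM2l// ler_expR; lra.
have geo n : \sum_(0 <= j < n) (A * q ^+ j) <= A / (1 - q).
  have -> : \sum_(0 <= j < n) (A * q ^+ j) = A * (1 - q ^+ n) / (1 - q).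
    elim: n => [|n IH]; first by rewrite big_nil expr0 subrr mulr0 mul0r.
    by rewrite big_nat_recr//= IH exprS; field; rewrite subr_eq0 gt_eqF.
  rewrite ler_pM2r ?invr_gt0 ?subr_gt0// ler_piMr ?(ltW A0)// gerBl.
  by rewrite exprn_ge0// ltW.
exists (lim_sup_set F).
  split.
    by apply: bigcapT_measurable => n; exact: bigcup_measurable.
  apply: lim_sup_set_cvg0 => //.
  apply: (@le_lt_trans _ _ (A / (1 - q))%:E); last exact: ltry.
  apply: lime_le; first exact: is_cvg_nneseries.
  apply: nearW => n; apply: (@le_trans _ _ (\sum_(0 <= j < n) (A * q ^+ j)%:E)%E).
    by apply: lee_sum => i _; exact: PF.
  by rewrite sumEFin lee_fin.
move=> w nF; have [j0 Fj0] : exists j0, forall j, (j0 <= j)%N -> ~ F j w.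
  apply: contrapT => h; apply: nF => j0 _; apply: contrapT => h'.
  by apply: h; exists j0 => j jj0 Fj; apply: h'; exists j.
exists j0 => j i /Fj0 nFj Nji; rewrite ltNge; apply/negP => Lij.
by apply: nFj; exists (i - N ^ j)%N => //=; rewrite subnKC.
Qed.

End agents.

(** * The two rates along all times *)

Theorem theorem11 (R : realType) (d : measure_display) (T : measurableType d)
    (P : probability T R) (sigma a : R) (G : probability R R)
    (s eps v : nat -> {RV P >-> R}) :
  0 < sigma -> 0 < a ->
  G (~` `[0, a]) = 0%E -> G [set 0] = 0%E ->
  (forall n B, measurable B -> distribution P (s n) B = normal_prob 1 sigma B) ->
  (forall n B, measurable B -> distribution P (eps n) B = G B) ->
  (forall n B, measurable B ->
     distribution P (v n) B = uniform_prob (@ltr01 R) B) ->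
  mutually_independent P (agent_family (fun n => s n : T -> R)
                            (fun n => eps n : T -> R) (fun n => v n : T -> R)) ->
  {ae P, forall w,
    let l := pub_llr sigma G (fun n => s n) (fun n => eps n) (fun n => v n) w in
    (exists C : R, \forall n \near \oo, `|l n| <= C * Num.sqrt n%:R) /\
    (exists2 c : R, 0 < c & \forall n \near \oo, c * ln n%:R <= l n)}.
Proof.
move=> sigma0 a0 Ga G0 s_law eps_law v_law indep.
have [K [C [c [b [c0 Hpm]]]]] := report_estimates sigma a G sigma0 a0 Ga G0.
have [B B0 HB] := llr_square_growth Hpm.
have [N N1 [F [mF PF0] HF]] := ae_pub_llr_geometric
  sigma0 Ga s_law eps_law v_law indep K C c b c0 Hpm.
exists F; split => // w /= nw; apply: contrapT => nFw; apply: nw; split.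
  (* The upper bound holds on every path and at every time. *)
  exists (Num.sqrt B); apply: nearW => n.
  rewrite -sqrtrM ?(ltW B0)// -sqrtr_sqr ler_sqrt ?mulr_ge0 ?(ltW B0)//.
  exact: pub_llr_square_bound HB n w.
have [j0 Lj0] := HF w nFw.
have N0 : 0 < ln N%:R :> R by rewrite ln_gt0// ltr1n.
(* For [j] the integer part of the logarithm of [n] in base [N],
   [ln n <= (j + 1) * ln N <= 2 * j * ln N], while the belief exceeds [j]. *)
exists (2 * ln N%:R)^-1; first by rewrite invr_gt0 mulr_gt0.
(* The successor forces [j > j0], hence [j >= 1], which absorbs the 1 in [j + 1]. *)
exists (N ^ j0.+1)%N => // n /= Nn.
have n0 : (0 < n)%N by apply: leq_trans Nn; rewrite expn_gt0 ltnW.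
pose j := trunc_log N n.
have jn : (N ^ j <= n)%N by exact: trunc_logP.
have nj : (n < N ^ j.+1)%N by exact: trunc_log_ltn.
have j0j : (j0 < j)%N by rewrite /j -(trunc_expnK j0.+1 N1) leq_trunc_log.
have j1 : 1 <= j%:R :> R by rewrite ler1n (leq_trans _ j0j).
apply: le_trans (ltW (Lj0 j n (ltnW j0j) jn)).
rewrite mulrC ler_pdivrMr ?mulr_gt0//.
apply: (@le_trans _ _ (ln (N ^ j.+1)%:R)).
  by rewrite ler_ln ?posrE ?ltr0n ?ler_nat ?expn_gt0 ?(ltnW nj)// (ltnW N1).
rewrite natrX lnXn ?ltr0n ?(ltnW N1)// -[leLHS]mulr_natl -[j.+1%:R]natr1; nra.
Qed.
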